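(* Let $$u(x)=-\frac1{(x-a)^2}+\sum_{k=0}^\infty c_k(x-a)^k$$ be the $4$-parameter Laurent series solution of the equation $$u_{xxxx}+10u_x^2+20uu_{xx}+40\bigl(u^3-6tu+6x\bigr)=0$$ (with free parameters $a,c_0,c_3,c_6$). Let $$\begin{aligned}A=\tfrac1{240}\bigl\{&[-4u_x\lambda-(12uu_x+u_{xxx})]\sigma_3+[8\lambda^2+8u\lambda+(12u^2+2u_{xx}-120t)]\sigma_+\\&+[8\lambda^3-8u\lambda^2-(4u^2+2u_{xx}+120t)\lambda+(16u^3-2u_x^2+4uu_{xx}+240x)]\sigma_-\bigr\},\end{aligned}$$ $$B=\sigma_++(\lambda-2u)\sigma_-,$$ $$C=\tfrac16u_x\sigma_3-\tfrac13(\lambda+u)\sigma_+-\tfrac13\bigl(\lambda^2-u\lambda-2u^2-\tfrac12u_{xx}\bigr)\sigma_-.$$ Then the gauge transformation $Z=R\Psi$ with the gauge matrix $$\begin{aligned}R(\lambda)=\;&2^{\frac12\sigma_3}(\lambda-2c_0)^{\frac12\sigma_3}(x-a)^{-\frac12\sigma_3}\tfrac1{\sqrt2}(\sigma_3+\sigma_1)\\&\times(\lambda-2c_0)^{-\frac12\sigma_3}2^{\frac12\sigma_3}(x-a)^{-\sigma_3}\tfrac1{\sqrt2}(\sigma_3+\sigma_1)(x-a)^{-\frac12\sigma_3}\end{aligned}$$ regularizes the connections $\partial_\lambda-A$ and $\partial_x-B$ along the singularity locus $x=a(t)$; and if the parameters, as functions of $t$, satisfy $c_0=a'$ and $c_3=2a''$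 (with $'=d/dt$), then it regularizes also the connection $\partial_t-C$ along the same locus.
   Context: $\sigma_3=\begin{pmatrix}1&0\\0&-1\end{pmatrix}$, $\sigma_1=\begin{pmatrix}0&1\\1&0\end{pmatrix}$, $\sigma_+=\begin{pmatrix}0&1\\0&0\end{pmatrix}$, $\sigma_-=\begin{pmatrix}0&0\\1&0\end{pmatrix}$; for a scalar $f$, $f^{s\sigma_3}=\mathrm{diag}(f^s,f^{-s})$ (for any fixed branch). In the Laurent series, $a,c_0,c_3,c_6$ are arbitrary and the other coefficients are determined recursively by the equation; the first ones are $c_1=0$, $c_2=3(c_0^2-2t)$, $c_4=\tfrac{30}7a-10c_0^3+\tfrac{120}7c_0t$, $c_5=3-\tfrac32c_0c_3$, $c_7=\tfrac{12}7(tc_3-c_0)$. The parameters $a,c_0,c_3,c_6$ may depend (smoothly) on $t$. The matrices $A,B,C$ are those of the linear system $\Psi_\lambda=A\Psi$, $\Psi_x=B\Psi$, $\Psi_t=C\Psi$. Under $Z=R\Psi$, the connection matrices become $RAR^{-1}+R_\lambda R^{-1}$, $RBR^{-1}+R_xR^{-1}$, $RCR^{-1}+R_tR^{-1}$, respectively. The gauge transformation regularizes a connection along $x=a(t)$ if the transformed connection matrix has no singularity at $x=a(t)$, i.e. its expansion in powers of $x-a$ contains no negative powers. *)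

(* Defs.v *)
From HB Require Import structures.
From mathcomp Require Import all_boot all_order all_algebra.
From mathcomp Require Import all_classical all_reals all_analysis.
From mathcomp Require Import complex.

Set Implicit Arguments.
Unset Strict Implicit.
Unset Printing Implicit Defensive.

Import Order.TTheory GRing.Theory Num.Theory.
Import numFieldNormedType.Exports.

Local Open Scope classical_set_scope.
Local Open Scope ring_scope.

(* Functions of several variables take their arguments in the order [l] (for
   lambda), [x], [t]. *)

(* At this type the topology and the norm of an arbitrary numFieldType are found
   by inference; they are not declared on [R[i]] itself. *)
Definition Cplx (R : realType) : numClosedFieldType := R[i].

Section ConvergentSeries.
Context {K : numClosedFieldType}.

Definition power_series_sum {V : normedModType K}
    (d : nat -> V) (z : K) (s : V) : Prop :=
  series (fun k => z ^+ k *: d k) @ \oo --> s.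

Definition smooth_on (D : set K) (f : K -> K) : Prop :=
  forall (n : nat) (t : K), D t -> derivable (f^`(n)%classic) t 1.

End ConvergentSeries.

Section LinearSystem.
Context {K : numClosedFieldType}.
Implicit Types (u : K -> K -> K) (l x t : K).

Definition mx2 (m00 m01 m10 m11 : K) : 'M[K]_2 :=
  \matrix_(i, j) (if i == 0 then if j == 0 then m00 else m01
                  else if j == 0 then m10 else m11).

Definition sigma1 : 'M[K]_2 := mx2 0 1 1 0.
Definition sigma3 : 'M[K]_2 := mx2 1 0 0 (-1).
Definition sigma_plus : 'M[K]_2 := mx2 0 1 0 0.
Definition sigma_minus : 'M[K]_2 := mx2 0 0 1 0.

Definition dx u (n : nat) x t : K := (u^~ t)^`(n)%classic x.

Definition solves_PI2_at u x t : Prop :=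
  dx u 4 x t + 10 * dx u 1 x t ^+ 2 + 20 * u x t * dx u 2 x t
    + 40 * (u x t ^+ 3 - 6 * t * u x t + 6 * x) = 0.

Definition connA u l x t : 'M[K]_2 :=
  let U := u x t in let U1 := dx u 1 x t in
  let U2 := dx u 2 x t in let U3 := dx u 3 x t in
  240^-1 *:
   ((- 4 * U1 * l - (12 * U * U1 + U3)) *: sigma3
    + (8 * l ^+ 2 + 8 * U * l + (12 * U ^+ 2 + 2 * U2 - 120 * t)) *: sigma_plus
    + (8 * l ^+ 3 - 8 * U * l ^+ 2 - (4 * U ^+ 2 + 2 * U2 + 120 * t) * l
       + (16 * U ^+ 3 - 2 * U1 ^+ 2 + 4 * U * U2 + 240 * x)) *: sigma_minus).

Definition connB u l x t : 'M[K]_2 :=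
  sigma_plus + (l - 2 * u x t) *: sigma_minus.

Definition connC u l x t : 'M[K]_2 :=
  let U := u x t in let U1 := dx u 1 x t in let U2 := dx u 2 x t in
  (6^-1 * U1) *: sigma3 - (3^-1 * (l + U)) *: sigma_plus
  - (3^-1 * (l ^+ 2 - U * l - 2 * U ^+ 2 - 2^-1 * U2)) *: sigma_minus.

(* [u x t = - (x - a t)^-2 + \sum_k c k t (x - a t)^k] on a punctured disc
   centred at [a t], where [u] moreover solves the equation. *)
Definition laurent_solution u (a : K -> K) (c : nat -> K -> K) t : Prop :=
  exists2 r : K, 0 < r & forall x, 0 < `|x - a t| < r ->
    (exists2 s : K^o, power_series_sum (fun k => c k t : K^o) (x - a t) s &
                      u x t = - (x - a t) ^- 2 + s)
    /\ solves_PI2_at u x t.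

End LinearSystem.

Section Gauge.
Context {K : numClosedFieldType}.
Implicit Types (a : K -> K) (l x t : K) (G M : K -> K -> K -> 'M[K]_2).

(* [f^(s sigma_3)], where [w = f^s]. *)
Definition sigma3_power (w : K) : 'M[K]_2 := mx2 w 0 0 w^-1.

(* [g] is a choice of [f^(1/2)]. No continuity is required, so this covers every
   branch (the single-valued ones on a domain can be extended arbitrarily). *)
Definition sqrt_branch (f g : K -> K -> K -> K) : Prop :=
  forall l x t, g l x t ^+ 2 = f l x t.

(* [gl] and [gx] are branches of [(l - 2 c0)^(1/2)] and [(x - a)^(1/2)]. *)
Definition gauge_matrix a (gl gx : K -> K -> K -> K) l x t : 'M[K]_2 :=
  let H := (sqrtC 2)^-1 *: (sigma3 + sigma1) in
  sigma3_power (sqrtC 2) *m sigma3_power (gl l x t) *m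
  sigma3_power (gx l x t)^-1 *m H *m
  sigma3_power (gl l x t)^-1 *m sigma3_power (sqrtC 2) *m
  sigma3_power (x - a t)^-1 *m H *m sigma3_power (gx l x t)^-1.

Definition gauge_l G M l x t : 'M[K]_2 :=
  G l x t *m M l x t *m invmx (G l x t)
  + (fun l' => G l' x t)^`()%classic l *m invmx (G l x t).

Definition gauge_x G M l x t : 'M[K]_2 :=
  G l x t *m M l x t *m invmx (G l x t)
  + (fun x' => G l x' t)^`()%classic x *m invmx (G l x t).

Definition gauge_t G M l x t : 'M[K]_2 :=
  G l x t *m M l x t *m invmx (G l x t)
  + (fun t' => G l x t')^`()%classic t *m invmx (G l x t).

(* At the given [t], the expansion of [M] in powers of [x - a t] contains no
   negative powers, for every [l] at which the gauge matrix is defined. *)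
Definition regular_along a (c0 : K -> K) M t : Prop :=
  exists2 r : K, 0 < r & forall l, l != 2 * c0 t ->
    exists d : nat -> 'M[K]_2, forall x, 0 < `|x - a t| < r ->
      power_series_sum d (x - a t) (M l x t).

End Gauge.

(* Main.v *)
(* Write [z = x - a] and [m = l - 2 c0]. All square roots cancel in the gauge
   matrix, which is the unimodular rational matrix
     [[g / z^2, h / z], [h / (2 m z), g / (2 m)]],  g = 1 + m z^2 / 2,  h = 1 - m z^2 / 2.
   For a traceless connection [[p, q], [s, -p]] the functions P = z^5 p, Q = z^4 q,
   S = z^6 s are power series in [z], and the entries (1,1), (1,2), (2,1) of the
   transformed connection are power series divided by 2 m z^7, z^8, 4 m^2 z^6.
   Hence regularity amounts to the vanishing of finitely many coefficients, which
   are polynomials in the Laurent coefficients of [u]. They vanish by the values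
   of c1, c2, c4, c5 that the equation forces, together with a' = c0 and
   2 c0' = c3 in the case of the [t]-connection. Derivatives of [u] are handled
   through z^(n+2) u^(n), a power series with coefficients
   (k - 2)(k - 3)...(k - n - 1) u_(k - 2). *)
Require Import Defs.
From mathcomp Require Import all_boot all_order all_algebra.
From mathcomp Require Import all_classical all_reals all_analysis.
From mathcomp Require Import complex ring zify.
Import Order.TTheory GRing.Theory Num.Theory.
Import numFieldNormedType.Exports.
Local Open Scope classical_set_scope.
Local Open Scope ring_scope.

(** * Power series over the complex numbers *)

Section GeometricBounds.
Context {K : numFieldType}.
Implicit Types th : K.

Lemma geometric_sum_le th n : 0 <= th < 1 ->
  \sum_(k < n) th ^+ k <= (1 - th)^-1.
Proof.
move=> /andP[th0 th1]; have d0 : 0 < 1 - th by rewrite subr_gt0.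
rewrite -[leRHS]mul1r ler_pdivlMr//.
have := subrX1 th n; rewrite -[th - 1]opprB mulNr => /eqP.
rewrite -eqr_oppLR opprB mulrC => /eqP <-.
by rewrite lerBlDr lerDl exprn_ge0.
Qed.

(** Each of the [n.+1] terms of the geometric sum is at least its last one, [th ^+ n]. *)
Lemma natr_geometric_le th n : 0 <= th < 1 ->
  n.+1%:R * th ^+ n <= (1 - th)^-1.
Proof.
move=> th01; apply: le_trans (geometric_sum_le th n.+1 th01).
case/andP: th01 => th0 th1; rewrite mulr_natl -[X in _ *+ X]card_ord -sumr_const.
by apply: ler_sum => i _; rewrite ler_wiXn2l// ?ltW// -ltnS.
Qed.

Lemma natr_geometric_dominated th : 0 <= th < 1 ->
  exists eta C : K, [/\ 0 <= eta < 1, 0 <= C &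
    forall n, n.+1%:R * th ^+ n <= C * eta ^+ n].
Proof.
(* The midpoint of [th] and [1] leaves room on both sides: the linear factor is absorbed by the
   ratio [th / eta < 1], and [eta] is still below [1]. *)
move=> /andP[th0 th1]; pose eta := (th + 1) / 2.
have [le_eta lt_eta] := (midf_lt th1).
have eta0 : 0 < eta by apply: le_lt_trans le_eta.
have q01 : 0 <= th / eta < 1 by rewrite divr_ge0 ?(ltW eta0)//= ltr_pdivrMr// mul1r.
exists eta, (1 - th / eta)^-1; split.
- by rewrite ltW.
- by rewrite invr_ge0 subr_ge0 ltW//; case/andP: q01.
- move=> n; have := natr_geometric_le _ n q01.
  rewrite -(@ler_pM2r _ (eta ^+ n)) ?exprn_gt0// -mulrA -exprMn divfK ?gt_eqF//.
Qed.

End GeometricBounds.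

Section PowerSeries.
Context {R : realType}.
Local Notation K := (Cplx R).
Implicit Types (a r x z s t rho M : K) (d e : nat -> K) (f g : K -> K).

(** Nonnegative elements of [R[i]] are real, so estimates on norms can be moved to [R], where limits
    of geometric sequences are known. *)
Lemma ge0_real_complex (x : K) : 0 <= x -> exists2 y : R, 0 <= y & x = (y%:C)%C.
Proof.
move=> x0; have /complex_realP[y yE] := ger0_real x0; exists y => //.
by rewrite -lecR -yE.
Qed.

Lemma near_geometric_lt (th C eps : K) : 0 <= th < 1 -> 0 <= C -> 0 < eps ->
  \forall n \near \oo, C * th ^+ n < eps.
Proof.
move=> /andP[th0 th1] C0 e0.
have [s s0 sE] := ge0_real_complex _ th0; have [c c0 cE] := ge0_real_complex _ C0.
have [e ee0 eE] := ge0_real_complex _ (ltW e0).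
have s1 : `|s| < 1 by rewrite ger0_norm// -ltcR -sE.
have e1 : 0 < e by rewrite -ltcR -eE.
have /cvgrPdist_lt/(_ e e1) := cvg_geometric c s1.
apply: filterS => n; rewrite sub0r normrN /= => h.
rewrite sE cE eE -rmorphXn -rmorphM ltcR.
by apply: le_lt_trans h; rewrite ler_norm.
Qed.

Lemma geometric_lb_le0 (th C x : K) : 0 <= th < 1 -> 0 <= C ->
  (forall n, x <= C * th ^+ n) -> x <= 0.
Proof.
move=> th01 C0 xC; apply/ler_addgt0Pr => eps e0; rewrite add0r.
have [N _ /(_ N (leqnn N)) h] := near_geometric_lt th C eps th01 C0 e0.
by rewrite (le_trans (xC N))// ltW.
Qed.

Lemma cvg_geometric_dist (u : nat -> K) (l th C : K) : 0 <= th < 1 -> 0 <= C ->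
  (forall n, `|l - u n| <= C * th ^+ n) -> u @ \oo --> l.
Proof.
move=> th01 C0 h; apply/cvgrPdist_lt => eps e0.
have := near_geometric_lt th C eps th01 C0 e0.
by apply: filterS => n; apply: le_lt_trans.
Qed.

Lemma normc_le_ReIm (x : K) : `|x| <= ((`|complex.Re x| + `|complex.Im x|)%:C)%C.
Proof.
rewrite {1}[x]complexE (le_trans (ler_normD _ _))// normrM rmorphD /=.
by apply: lerD; rewrite !normc_def /= ?expr0n ?expr1n /= ?addr0 ?add0r ?sqrtr1
  ?mul1r ?sqrtr_sqr.
Qed.

(** Completeness is taken from [R]: the real and imaginary parts of the series are each absolutely
    dominated by a real geometric series. *)
Lemma geometric_dominated_cvg (e : nat -> K) (th M : K) : 0 <= th < 1 -> 0 <= M ->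
  (forall k, `|e k| <= M * th ^+ k) ->
  exists2 s : K, series e @ \oo --> s &
    forall n, `|s - \sum_(k < n) e k| <= M / (1 - th) * th ^+ n.
Proof.
move=> th01 M0 eM; have /andP[th0 th1] := th01.
have [t t0 tE] := ge0_real_complex _ th0; have [c c0 cE] := ge0_real_complex _ M0.
have t1 : `|t| < 1 by rewrite ger0_norm// -ltcR -tE.
have part (p : K -> R) : (forall x, (`|p x|%:C)%C <= `|x|) ->
    cvgn (series (p \o e)).
  move=> px; apply: normed_cvg; apply: (@series_le_cvg _ _ (geometric c t)).
  - by move=> n; exact: normr_ge0.
  - by move=> n /=; rewrite mulr_ge0// exprn_ge0.
  - move=> n /=; rewrite -lecR (le_trans (px _))// (le_trans (eM n))//.
    by rewrite cE tE -rmorphXn -rmorphM.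
  - exact: is_cvg_geometric_series.
have /part := @normc_ge_Re R; move=> /cvg_ex[/= s1 cs1].
(* The imaginary part of [x] is minus the real part of [x * 'i], and multiplication by ['i]
   preserves the norm. *)
have normc_ge_Im (x : K) : (`|complex.Im x|%:C)%C <= `|x|.
  have := @normc_ge_Re R (x * 'i%C); rewrite ReiNIm normrN normrM.
  by rewrite [`|'i%C|]normc_def /= expr0n expr1n add0r sqrtr1 mulr1.
have /part := normc_ge_Im; move=> /cvg_ex[/= s2 cs2].
pose s : K := (s1 +i* s2)%C.
have cs : series e @ \oo --> s.
  apply/cvgrPdist_lt => eps e0; have [ep ep0 epE] := ge0_real_complex _ (ltW e0).
  have ep1 : 0 < ep / 2 by rewrite divr_gt0// -ltcR -epE.
  move/cvgrPdist_lt/(_ _ ep1): cs1 => cs1; move/cvgrPdist_lt/(_ _ ep1): cs2 => cs2.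
  near=> n; apply: le_lt_trans (normc_le_ReIm _) _; rewrite epE ltcR [ltRHS]splitr.
  have ReE : complex.Re (series e n) = series (@complex.Re R \o e) n.
    by rewrite /series/= raddf_sum.
  have ImE : complex.Im (series e n) = series (@complex.Im R \o e) n.
    by rewrite /series/= raddf_sum.
  apply: ltrD.
    by rewrite raddfB /= ReE; near: n.
  by rewrite raddfB /= ImE; near: n.
exists s => // n.
(* Up to [eps], the limit is a partial sum of some index [N >= n]; the block from [n] to [N] is a
   geometric sum with first term [M * th ^+ n]. *)
apply/ler_addgt0Pr => eps e0.
move/cvgrPdist_lt/(_ _ e0): cs => cs.
have : \forall N \near \oo, (n <= N)%N by exists n.
move=> /(filterI cs) /filter_ex[N [/= sN nN]].
rewrite -(subrKA (series e N)) (le_trans (ler_normD _ _))// [leRHS]addrC.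
apply: lerD; first exact: ltW.
rewrite -(big_mkord predT e) -/(series e n) sub_series_geq//.
rewrite (le_trans (ler_norm_sum _ _ _))//.
rewrite -{1}[n]add0n big_addn big_mkord.
apply: (@le_trans _ _ (\sum_(k < N - n) M * th ^+ n * th ^+ k)).
  by apply: ler_sum => k _; rewrite (le_trans (eM _))// addnC exprD mulrA.
by rewrite -mulr_sumr [leRHS]mulrAC ler_wpM2l ?geometric_sum_le// mulr_ge0// exprn_ge0.
Unshelve. all: by end_near.
Qed.

Lemma cvg_norm_le (u : nat -> K) (l B : K) :
  u @ \oo --> l -> (forall n, `|u n| <= B) -> `|l| <= B.
Proof.
move=> ul uB; apply/ler_addgt0Pr => eps e0.
move/cvgrPdist_lt/(_ _ e0)/filter_ex: ul => [n /= ln].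
by rewrite -[l](subrK (u n)) (le_trans (ler_normD _ _))// addrC lerD// ltW.
Qed.

Lemma power_series_partialE d z n :
  series (fun k => z ^+ k *: (d k : K^o)) n = \sum_(k < n) z ^+ k * d k :> K.
Proof. by rewrite /series/= big_mkord. Qed.

Lemma power_series_sum_unique d z s t :
  power_series_sum (d : nat -> K^o) z s -> power_series_sum (d : nat -> K^o) z t ->
  s = t.
Proof. by move=> /cvg_lim <-// /cvg_lim <-. Qed.

Lemma power_series_term_le d z rho M : `|z| < rho ->
  (forall k, `|d k| * rho ^+ k <= M) ->
  forall k, `|z ^+ k * d k| <= M * (`|z| / rho) ^+ k.
Proof.
move=> zr dM k; have rho0 : 0 < rho by exact: le_lt_trans zr.
rewrite expr_div_n mulrA ler_pdivlMr ?exprn_gt0// normrM normrX -mulrA mulrC.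
by rewrite ler_wpM2r ?exprn_ge0.
Qed.

Lemma ratio_itv z rho : `|z| < rho -> 0 <= `|z| / rho < 1.
Proof.
move=> zr; have rho0 : 0 < rho by exact: le_lt_trans zr.
by rewrite divr_ge0 ?(ltW rho0)//= ltr_pdivrMr// mul1r.
Qed.

Lemma power_series_bound_ge0 d rho M : (forall k, `|d k| * rho ^+ k <= M) -> 0 <= M.
Proof. by move=> /(_ 0%N); rewrite expr0 mulr1; apply: le_trans. Qed.

Lemma power_series_sum_exists d z rho M : `|z| < rho ->
  (forall k, `|d k| * rho ^+ k <= M) ->
  exists s, power_series_sum (d : nat -> K^o) z s.
Proof.
move=> zr dM; have [s cs _] := geometric_dominated_cvg _ _ _ (ratio_itv _ _ zr)
  (power_series_bound_ge0 _ _ _ dM) (power_series_term_le _ _ _ _ zr dM).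
by exists s.
Qed.

Lemma power_series_sum_tail d z rho M s : `|z| < rho ->
  (forall k, `|d k| * rho ^+ k <= M) -> power_series_sum (d : nat -> K^o) z s ->
  forall n, `|s - \sum_(k < n) z ^+ k * d k| <=
    M / (1 - `|z| / rho) * (`|z| / rho) ^+ n.
Proof.
move=> zr dM ds; have [t ct tM] := geometric_dominated_cvg _ _ _ (ratio_itv _ _ zr)
  (power_series_bound_ge0 _ _ _ dM) (power_series_term_le _ _ _ _ zr dM).
by rewrite (power_series_sum_unique _ _ _ _ ds ct).
Qed.

(** * Cauchy products *)

Definition convolution d e k : K := \sum_(i < k.+1) d i * e (k - i)%N.

(** Both sides sum over the triangle [i + j < n]: by diagonals on the left, by rows on the right. *)
Lemma convolution_partial d e z n :
  \sum_(k < n) z ^+ k * convolution d e k =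
  \sum_(i < n) (z ^+ i * d i) * (\sum_(j < n - i) z ^+ j * e j).
Proof.
elim: n => [|n IHn]; first by rewrite !big_ord0.
rewrite big_ord_recr/= IHn [RHS]big_ord_recr/= subSnn big_ord1.
rewrite /convolution big_ord_recr/= subnn mulrDr addrA; congr (_ + _); last by ring.
rewrite mulr_sumr -big_split; apply: eq_bigr => i _ /=.
rewrite subSn ?(ltnW (ltn_ord i))// big_ord_recr/= mulrDr; congr (_ + _).
by rewrite -[in z ^+ n](subnKC (ltnW (ltn_ord i))) exprD; ring.
Qed.

Lemma power_series_sumM d e z rho M N s t : `|z| < rho ->
  (forall k, `|d k| * rho ^+ k <= M) -> (forall k, `|e k| * rho ^+ k <= N) ->
  power_series_sum (d : nat -> K^o) z s -> power_series_sum (e : nat -> K^o) z t ->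
  power_series_sum (convolution d e : nat -> K^o) z (s * t).
Proof.
move=> zr dM eN ds et; have th01 := ratio_itv _ _ zr.
have sM := power_series_sum_tail _ _ _ _ _ zr dM ds.
have tN := power_series_sum_tail _ _ _ _ _ zr eN et.
have [M0 N0] := (power_series_bound_ge0 _ _ _ dM, power_series_bound_ge0 _ _ _ eN).
set th := `|z| / rho in th01 sM tN; have /andP[th0 th1] := th01.
have D0 : 0 <= (1 - th)^-1 by rewrite invr_ge0 subr_ge0 ltW.
(* The error estimate carries a factor linear in [n]; it is traded for the larger ratio [eta]. *)
have [eta [C [eta01 C0 thC]]] := natr_geometric_dominated _ th01.
pose B := (M / (1 - th) * `|t| + M * (N / (1 - th))).
have B0 : 0 <= B by rewrite addr_ge0// !mulr_ge0.
apply: (cvg_geometric_dist _ _ eta (B * C)) => //; first exact: mulr_ge0.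
move=> n; rewrite power_series_partialE convolution_partial.
(* The error is [(s - S_n) t + \sum_i d_i z^i (t - T_(n - i))], which the tail
   bounds make [O(n th^n)]. *)
have -> : s * t - \sum_(i < n) (z ^+ i * d i) * (\sum_(j < n - i) z ^+ j * e j) =
    (s - \sum_(i < n) z ^+ i * d i) * t +
    \sum_(i < n) (z ^+ i * d i) * (t - \sum_(j < n - i) z ^+ j * e j).
  rewrite mulrBl -addrA; congr (_ + _).
  rewrite mulr_suml -!sumrN -big_split/=; apply: eq_bigr => i _.
  by rewrite mulrBr addrA addNr add0r.
rewrite (le_trans (ler_normD _ _))// -mulrA.
apply: (@le_trans _ _ (B * (n.+1%:R * th ^+ n))); last by rewrite ler_wpM2l.
rewrite /B [leRHS]mulrDl; apply: lerD.
  rewrite normrM [leRHS]mulrAC ler_wpM2r// (le_trans (sM n))// ler_wpM2l ?mulr_ge0//.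
  by rewrite ler_peMl ?exprn_ge0// ler1n.
rewrite (le_trans (ler_norm_sum _ _ _))//.
apply: (@le_trans _ _ (\sum_(i < n) M * (N / (1 - th)) * th ^+ n)).
  apply: ler_sum => i _; rewrite normrM.
  have := power_series_term_le _ _ _ _ zr dM i; rewrite -/th => di.
  have := ler_pM (normr_ge0 _) (normr_ge0 _) di (tN (n - i)%N).
  move=> /le_trans; apply; rewrite mulrACA -exprD subnKC// ltnW//.
rewrite sumr_const card_ord -[leLHS]mulr_natl [leLHS]mulrCA ler_wpM2l ?mulr_ge0//.
by rewrite ler_wpM2r ?exprn_ge0// ler_nat.
Qed.

(** * Radius of convergence and termwise differentiation *)

Definition has_radius r d := forall rho, 0 < rho < r ->
  exists M, forall k, `|d k| * rho ^+ k <= M.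

(** The disc is punctured, so nothing is asked of the value of [f] at [a], where [f] may come from a
    function with a pole. *)
Definition expansion a r f d := forall x, 0 < `|x - a| < r ->
  power_series_sum (d : nat -> K^o) (x - a) (f x).

(** Abel's lemma: convergence at the point [rho] makes the terms tend to [0], hence bounded. The
    bound takes [1] for the tail and the whole sum of the first [N] norms for the rest. *)
Lemma power_series_sum_radius r d :
  (forall z, 0 < `|z| < r -> exists s, power_series_sum (d : nat -> K^o) z s) ->
  has_radius r d.
Proof.
move=> dz rho rho0r; have /andP[rho0 rhor] := rho0r.
have [|s ds] := dz rho; first by rewrite gtr0_norm.
have /cvgrPdist_lt/(_ 1 ltr01)[N _ Nd] :=
  cvg_series_cvg_0 (cvgP _ ds).
exists (1 + \sum_(k < N) `|d k| * rho ^+ k) => k.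
have nn j : 0 <= `|d j| * rho ^+ j by rewrite mulr_ge0// exprn_ge0// ltW.
have [Nk|kN] := leqP N k.
  apply: (@le_trans _ _ 1); last by rewrite lerDl sumr_ge0.
  have := Nd k Nk; rewrite /= sub0r normrN normrM normrX (gtr0_norm rho0) mulrC.
  exact: ltW.
rewrite (bigD1 (Ordinal kN))//= addrCA lerDl addr_ge0// sumr_ge0// => i _.
Qed.

Lemma power_series_partial_cvg d z s : power_series_sum (d : nat -> K^o) z s ->
  (fun n => \sum_(k < n) z ^+ k * d k) @ \oo --> s.
Proof.
by rewrite /power_series_sum (funext (power_series_partialE d z)).
Qed.

Lemma expansion_radius a r f d : expansion a r f d -> has_radius r d.
Proof.
move=> fd; apply: power_series_sum_radius => z zr.
by exists (f (z + a)); have := fd (z + a); rewrite addrK; apply.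
Qed.

Lemma radius_between r z : `|z| < r -> exists2 rho, 0 < rho < r & `|z| < rho.
Proof.
move=> zr; have [h1 h2] := midf_lt zr; exists ((`|z| + r) / 2) => //.
by rewrite h2 andbT (le_lt_trans _ h1).
Qed.

Lemma has_radius_sum r d z : has_radius r d -> `|z| < r ->
  exists s, power_series_sum (d : nat -> K^o) z s.
Proof.
move=> dr /radius_between[rho rhor zrho]; have [M dM] := dr _ rhor.
exact: power_series_sum_exists zrho dM.
Qed.

(** The factor [k] is paid for by the Cauchy estimate at a slightly larger radius [sg]. The sequence
    [k%:R * d k] belongs to [z f'(z)] rather than to [f'(z)], which avoids shifting indices. *)
Lemma has_radius_deriv r d : has_radius r d -> has_radius r (fun k => k%:R * d k).
Proof.
move=> dr rho /andP[rho0 rhor].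
have /radius_between[sg /andP[sg0 sgr] rsg] : `|rho| < r by rewrite gtr0_norm.
have [|M dM] := dr sg; first by rewrite sg0.
have th01 := ratio_itv _ _ rsg; have M0 := power_series_bound_ge0 _ _ _ dM.
exists (M * (1 - `|rho| / sg)^-1) => k.
apply: (@le_trans _ _ (M * (k.+1%:R * (`|rho| / sg) ^+ k))).
  have := power_series_term_le _ _ _ _ rsg dM k.
  rewrite normrM normrX (gtr0_norm rho0) mulrC => h.
  rewrite normrM normr_nat -mulrA [leRHS]mulrCA.
  by apply: ler_pM => //; rewrite ?mulr_ge0 ?exprn_ge0 ?(ltW rho0)// ler_nat.
by rewrite ler_wpM2l// natr_geometric_le.
Qed.

(* The bound is stated with [rho ^+ k], both sides being multiplied by
   [rho ^+ 2], to avoid the exponent [k - 2]. *)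
Lemma expr_taylor1_le rho (z h : K) k : `|z| <= rho -> `|z + h| <= rho ->
  `|(z + h) ^+ k - z ^+ k - h * (k%:R * z ^+ k.-1)| * rho ^+ 2
    <= k%:R ^+ 2 * rho ^+ k * `|h| ^+ 2.
Proof.
move=> zr zhr; have rho0 : 0 <= rho by apply: le_trans zr.
elim: k => [|k IHk].
  by rewrite !expr0 !subrr mul0r mulr0 subr0 normr0 mul0r !mulr_ge0// exprn_ge0.
(* The remainder of order [k.+1] is [z + h] times that of order [k], plus one quadratic term; the
   constants close up because [k^2 + k <= (k + 1)^2]. At [k = 0] the truncated exponent [k.-1] is
   multiplied by [0]. *)
have -> : (z + h) ^+ k.+1 - z ^+ k.+1 - h * (k.+1%:R * z ^+ k.+1.-1) =
    (z + h) * ((z + h) ^+ k - z ^+ k - h * (k%:R * z ^+ k.-1))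
    + k%:R * h ^+ 2 * z ^+ k.-1.
  case: k {IHk} => [|k] /=; first by rewrite !expr0 expr1; ring.
  by rewrite !exprS -!natr1; ring.
apply: (@le_trans _ _ (rho * (k%:R ^+ 2 * rho ^+ k * `|h| ^+ 2)
                       + k%:R * `|h| ^+ 2 * rho ^+ k.+1)).
  apply: le_trans (ler_wpM2r (exprn_ge0 2 rho0) (ler_normD _ _)) _.
  rewrite mulrDl normrM -mulrA; apply: lerD.
    by apply: ler_pM => //; rewrite mulr_ge0// exprn_ge0.
  rewrite !normrM !normrX normr_nat -mulrA.
  case: k {IHk} => [|k] /=; first by rewrite !mul0r.
  rewrite ler_wpM2l ?mulr_ge0 ?exprn_ge0// -[k.+2]addn2 exprD.
  by rewrite ler_wpM2r ?exprn_ge0// lerXn2r.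
have -> : rho * (k%:R ^+ 2 * rho ^+ k * `|h| ^+ 2) + k%:R * `|h| ^+ 2 * rho ^+ k.+1
    = (k%:R ^+ 2 + k%:R) * (rho ^+ k.+1 * `|h| ^+ 2) by rewrite ![rho ^+ k.+1]exprS; ring.
rewrite -mulrA ler_wpM2r ?mulr_ge0 ?exprn_ge0//.
by rewrite -natrX -natrD -natrX ler_nat; nia.
Qed.

(* [s / z] is the termwise derivative; the quadratic bound holds for all partial
   sums with the same [M], so it passes to the limit. *)
Lemma power_series_derivative r d z s : 0 < `|z| < r -> has_radius r d ->
  power_series_sum ((fun k => k%:R * d k) : nat -> K^o) z s ->
  exists rho M, [/\ 0 < rho, `|z| < rho < r, 0 <= M & forall h t t', `|z + h| <= rho ->
    power_series_sum (d : nat -> K^o) z t ->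
    power_series_sum (d : nat -> K^o) (z + h) t' ->
    `|t' - t - h * (s / z)| <= M * `|h| ^+ 2].
Proof.
move=> /andP[z0 zr] dr ds.
have [rho /andP[rho0 rhor] zrho] := radius_between _ _ zr.
have rho1 : `|rho| < r by rewrite gtr0_norm.
have [sg sg0r rsg] := radius_between _ _ rho1.
(* Applying the lemma twice bounds [k^2 |d k| sg^k], which matches the factor [k^2] of
   [expr_taylor1_le]. *)
have [M dM] := has_radius_deriv _ _ (has_radius_deriv _ _ dr) _ sg0r.
have M0 := power_series_bound_ge0 _ _ _ dM; have th01 := ratio_itv _ _ rsg.
exists rho, (M / (1 - `|rho| / sg) / rho ^+ 2); split => //.
- by rewrite zrho.
- by rewrite !divr_ge0 ?exprn_ge0 ?(ltW rho0)// subr_ge0 ltW//; case/andP: th01.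
move=> h t t' zh dt dt'.
pose u n := \sum_(k < n) (z + h) ^+ k * d k - \sum_(k < n) z ^+ k * d k
  - h * ((\sum_(k < n) z ^+ k * (k%:R * d k)) / z).
have cu : u @ \oo --> t' - t - h * (s / z).
  rewrite /u; apply: cvgB; first by apply: cvgB; exact: power_series_partial_cvg.
  apply: cvgM; first exact: cvg_cst.
  by apply: cvgM; [exact: (power_series_partial_cvg _ _ _ ds)|exact: cvg_cst].
apply: (cvg_norm_le _ _ _ cu) => n.
have zn0 : z != 0 by rewrite -normr_gt0.
have -> : u n = \sum_(k < n) d k * ((z + h) ^+ k - z ^+ k - h * (k%:R * z ^+ k.-1)).
  rewrite /u mulr_suml mulr_sumr -!sumrB; apply: eq_bigr => -[[|k] _] _ /=.
    by rewrite !mul0r mulr0 mul0r mulr0; ring.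
  by rewrite !exprS; field.
rewrite [leRHS]mulrAC ler_pdivlMr ?exprn_gt0// [leRHS]mulrAC.
apply: le_trans (ler_wpM2r (exprn_ge0 2 (ltW rho0)) (ler_norm_sum _ _ _)) _.
rewrite mulr_suml.
apply: (@le_trans _ _ (\sum_(k < n) M * `|h| ^+ 2 * (`|rho| / sg) ^+ k)).
  apply: ler_sum => k _; rewrite normrM -mulrA.
  apply: le_trans (ler_wpM2l (normr_ge0 _) (expr_taylor1_le _ _ _ k (ltW zrho) zh)) _.
  rewrite mulrA [leRHS]mulrAC ler_wpM2r ?exprn_ge0//.
  have := power_series_term_le _ _ _ _ rsg dM k.
  rewrite !normrM normrX normr_nat (gtr0_norm rho0) => /(le_trans _); apply.
  by rewrite le_eqVlt; apply/orP; left; apply/eqP; ring.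
rewrite -mulr_sumr ler_wpM2l ?geometric_sum_le//.
by rewrite mulr_ge0// exprn_ge0.
Qed.

End PowerSeries.

(** * Derivative rules for inverse powers, inverses and multiples of a fixed vector *)

Lemma near_dist_lt {K : numFieldType} {V : normedModType K} (x : V) (e : K) :
  0 < e -> \forall y \near x, `|x - y| < e.
Proof. by move=> e0; apply: (@cvgr_dist_lt _ _ _ _ _ id x cvg_id _ e0). Qed.

Lemma scale_regularE {K : pzRingType} (b : K) (v : K^o) : b *: v = b * v.
Proof. by []. Qed.

Lemma is_derive_invX {K : numFieldType} (a x : K) n : x != a ->
  is_derive x 1 (fun y : K => (y - a) ^- n) (- (n%:R * (x - a) ^- n.+1)).
Proof.
move=> xa; have z0 : x - a != 0 by rewrite subr_eq0.
pose P (y : K) := y - a.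
have dP : is_derive x (1 : K) P 1 by apply: is_derive_eq; rewrite subr0.
have dPn := is_deriveX n dP.
have Pn0 : (P ^+ n) x != 0 by rewrite exprfctE expf_neq0.
have -> : (fun y : K => (y - a) ^- n) = (fun y => ((P ^+ n) y)^-1).
  by apply/funext => y; rewrite exprfctE.
apply: DeriveDef; first by apply: derivableV => //; apply: ex_derive.
rewrite deriveV// derive_val /P exprfctE !scale_regularE.
case: n {dPn Pn0} => [|n]; first by rewrite !mul0r mulr0 oppr0.
by rewrite !exprS /=; field; rewrite ?expf_neq0.
Qed.

Lemma is_deriveZr {K : numFieldType} {V : normedModType K} (f : K -> K) (x l : K) (v : V) :
  is_derive x 1 f l -> is_derive x 1 (fun y => f y *: v) (l *: v).
Proof.
move=> [df <-].
have cf : h^-1 *: (((fun y => f y *: v) \o shift x) (h *: 1) - f x *: v) @[h --> 0^']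
    --> 'D_1 f x *: v.
  have -> : (fun h => h^-1 *: (((fun y => f y *: v) \o shift x) (h *: 1) - f x *: v)) =
      (fun h => (h^-1 *: ((f \o shift x) (h *: 1) - f x)) *: v).
    by apply/funext => h; rewrite /= -scalerBl scalerA.
  exact: cvgZr_tmp.
by apply: DeriveDef; [apply/cvg_ex; exists ('D_1 f x *: v)|exact: cvg_lim].
Qed.

Lemma is_derive_inv {K : numFieldType} (f : K -> K) (x l : K) : f x != 0 ->
  is_derive x 1 f l -> is_derive x 1 (fun y => (f y)^-1) (- (f x)^-1 ^+ 2 * l).
Proof.
move=> f0 [df <-]; apply: DeriveDef; first exact: derivableV.
by rewrite deriveV// scale_regularE exprVn.
Qed.

Definition delta_coef {K : pzRingType} (n k : nat) : K := (k == n)%:R.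

Definition shift_coef {K : pzRingType} (n : nat) (d : nat -> K) (k : nat) : K :=
  if (k < n)%N then 0 else d (k - n)%N.

(** * Calculus of expansions on a punctured disc *)

Section Expansions.
Context {R : realType}.
Local Notation K := (Cplx R).
Implicit Types (a r x z s t rho M : K) (d e : nat -> K) (f g : K -> K).

Lemma power_series_sumD {V : normedModType K} (D E : nat -> V) z (S T : V) :
  power_series_sum D z S -> power_series_sum E z T ->
  power_series_sum (fun k => D k + E k) z (S + T).
Proof.
move=> DS ET; rewrite /power_series_sum.
have -> : (fun k => z ^+ k *: (D k + E k)) =
    (fun k => z ^+ k *: D k) + (fun k => z ^+ k *: E k).
  by apply/funext => k; rewrite scalerDr.
by rewrite seriesD; apply: cvgD.
Qed.

Lemma power_series_sumZr {V : normedModType K} d z s (v : V) :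
  power_series_sum (d : nat -> K^o) z s ->
  power_series_sum (fun k => d k *: v) z (s *: v).
Proof.
move=> ds; rewrite /power_series_sum.
have -> : series (fun k => z ^+ k *: (d k *: v)) =
    (fun n => series (fun k => z ^+ k *: (d k : K^o)) n *: v).
  by apply/funext => n; rewrite /series/= scaler_suml; apply: eq_bigr => k _; rewrite scalerA.
exact: cvgZr_tmp.
Qed.

Section Ring.
Variables a r : K.

Lemma eq_expansion f g d : (forall x, 0 < `|x - a| < r -> f x = g x) ->
  expansion a r f d -> expansion a r g d.
Proof. by move=> fg fd x xr; rewrite -fg//; exact: fd. Qed.

Lemma expansionD f g d e : expansion a r f d -> expansion a r g e ->
  expansion a r (fun x => f x + g x) (fun k => d k + e k).
Proof. by move=> fd ge x xr; apply: (@power_series_sumD K^o); [exact: fd|exact: ge]. Qed.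

Lemma expansionM f g d e : expansion a r f d -> expansion a r g e ->
  expansion a r (fun x => f x * g x) (convolution d e).
Proof.
move=> fd ge x xr; have /andP[x0 xr1] := xr.
have [rho rhor xrho] := radius_between _ _ xr1.
have [M dM] := expansion_radius _ _ _ _ fd _ rhor.
have [N eN] := expansion_radius _ _ _ _ ge _ rhor.
exact: (power_series_sumM _ _ _ _ _ _ _ _ xrho dM eN (fd _ xr) (ge _ xr)).
Qed.

Lemma expansion_shift n f d : expansion a r f d ->
  expansion a r (fun x => (x - a) ^+ n * f x)
                (fun k => if (k < n)%N then 0 else d (k - n)%N).
Proof.
move=> fd x xr; rewrite /power_series_sum -(cvg_shiftn n) /=.
have -> : (fun m => series (fun k => (x - a) ^+ k *:
      ((if (k < n)%N then 0 else d (k - n)%N) : K^o)) (m + n)%N) =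
    (fun m => (x - a) ^+ n * series (fun k => (x - a) ^+ k *: (d k : K^o)) m).
  apply/funext => m; rewrite !power_series_partialE (addnC m n) big_split_ord /=.
  rewrite big1 ?add0r => [|i _]; last by rewrite ltn_ord mulr0.
  rewrite mulr_sumr; apply: eq_bigr => i _.
  by rewrite ltnNge leq_addr /= addKn exprD mulrA.
by apply: cvgM; [exact: cvg_cst|exact: fd].
Qed.

Lemma expansion_cst (b : K) :
  expansion a r (fun=> b) (fun k => if (k < 1)%N then b else 0).
Proof.
move=> x xr; rewrite /power_series_sum -(cvg_shiftn 1) /=.
apply: cvg_near_cst; apply: nearW => m.
rewrite power_series_partialE addn1 big_ord_recl /= expr0 mul1r.
by rewrite big1 ?addr0// => i _; rewrite mulr0.
Qed.

Lemma expansionZ (b : K) f d : expansion a r f d ->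
  expansion a r (fun x => b * f x) (fun k => b * d k).
Proof.
move=> fd x xr; rewrite mulrC.
have -> : (fun k => b * d k) = (fun k => d k * b) by apply/funext => k; rewrite mulrC.
exact: (@power_series_sumZr K^o _ _ _ b (fd x xr)).
Qed.

(** This is how the vanishing of finitely many coefficients becomes the absence of negative
    powers. *)
Lemma expansion_div n f d : expansion a r f d -> (forall k, (k < n)%N -> d k = 0) ->
  expansion a r (fun x => f x / (x - a) ^+ n) (fun k => d (k + n)%N).
Proof.
move=> fd d0 x xr; have := fd x xr; have /andP[x0 _] := xr.
have xn0 : (x - a) ^+ n != 0 by rewrite expf_neq0// -normr_gt0.
rewrite /power_series_sum -(cvg_shiftn n) => h; rewrite /power_series_sum.
rewrite mulrC; set c := ((x - a) ^+ n)^-1.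
have -> : series (fun k => (x - a) ^+ k *: (d (k + n)%N : K^o)) =
  (fun m => c * series (fun k => (x - a) ^+ k *: (d k : K^o)) (m + n)%N).
  apply/funext => m; rewrite !power_series_partialE (addnC m n) big_split_ord /=.
  rewrite [in RHS]big1 ?add0r => [|i _]; last by rewrite (d0 _ (ltn_ord i)) mulr0.
  rewrite mulr_sumr; apply: eq_bigr => i _.
  by rewrite addnC exprD /c; field.
by apply: cvgM; [exact: cvg_cst|exact: h].
Qed.

(** Identity theorem. Dividing by [(x - a) ^+ k] once the lower coefficients vanish leaves only the
    constant coefficient to treat, and this one is bounded by the tail of the series at points
    tending to [a]. *)
Lemma expansion_eq0 d : 0 < r -> expansion a r (fun=> 0) d -> forall k, d k = 0.
Proof.
move=> r0; suff e0 e : expansion a r (fun=> 0) e -> e 0%N = 0.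
  move=> dz; elim/ltn_ind => k IHk; apply: (e0 (fun j => d (j + k)%N)).
  by apply: eq_expansion (expansion_div _ _ _ dz IHk) => x _; rewrite mul0r.
move=> ez; have r2 : `|0 : K| < r by rewrite normr0.
have [rho rhor _] := radius_between _ _ r2; have /andP[rho0 rhor1] := rhor.
have [M eM] := expansion_radius _ _ _ _ ez _ rhor.
have M0 := power_series_bound_ge0 _ _ _ eM.
have h01 : 0 <= (2^-1 : K) < 1 by rewrite invr_ge0 ler0n invf_lt1// ltr1n.
have h0 : 0 < (2^-1 : K) by rewrite invr_gt0.
apply/eqP; rewrite -normr_le0; apply: (geometric_lb_le0 _ M _ h01 M0) => n.
(* At this point the ratio [q] in the tail bound is [2^-(n+1)], which is at most [1/2] even for
   [n = 0]; hence [M q / (1 - q) <= M 2^-n]. *)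
pose x := a + rho * 2^-1 ^+ n.+1.
have xa : x - a = rho * 2^-1 ^+ n.+1 by rewrite /x addrC addKr.
have q0 : 0 < (2^-1 : K) ^+ n.+1 by rewrite exprn_gt0.
have q1 : (2^-1 : K) ^+ n.+1 <= 2^-1.
  by rewrite -[leRHS]expr1 ler_wiXn2l// ltW//; case/andP: h01.
have nxa : `|x - a| = rho * 2^-1 ^+ n.+1 by rewrite xa gtr0_norm// mulr_gt0.
have xrho : `|x - a| < rho.
  rewrite nxa gtr_pMr//; apply: le_lt_trans q1 _; by case/andP: h01.
have xr : 0 < `|x - a| < r by rewrite (lt_trans xrho)// nxa mulr_gt0.
have := power_series_sum_tail _ _ _ _ _ xrho eM (ez _ xr) 1.
rewrite big_ord_recl big_ord0 addr0 expr0 mul1r sub0r normrN expr1 => /le_trans; apply.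
have -> : `|x - a| / rho = 2^-1 ^+ n.+1 by rewrite nxa mulrC mulKf// gt_eqF.
rewrite -mulrA ler_wpM2l//.
rewrite ler_pdivrMl; last first.
  by rewrite subr_gt0; apply: le_lt_trans q1 _; case/andP: h01.
rewrite exprS ler_wpM2r ?exprn_ge0 ?(ltW h0)//.
apply: (@le_trans _ _ (1 - 2^-1)); last by rewrite lerD2l lerN2 -exprS.
by have -> : 1 - 2^-1 = 2^-1 :> K by field.
Qed.

End Ring.

Lemma eq_expansion_coef (a r : K) (f g : K -> K) (d e : nat -> K) :
  (forall x, 0 < `|x - a| < r -> f x = g x) -> d =1 e ->
  expansion a r f d -> expansion a r g e.
Proof. by move=> fg /funext <-; exact: eq_expansion. Qed.

Lemma expansionB (a r : K) (f g : K -> K) (d e : nat -> K) :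
  expansion a r f d -> expansion a r g e ->
  expansion a r (fun x => f x - g x) (fun k => d k - e k).
Proof.
move=> fd ge; have h := expansionD _ _ _ _ _ _ fd (expansionZ _ _ (-1) _ _ ge).
by apply: eq_expansion_coef h => [x _|k]; rewrite mulN1r.
Qed.

Lemma expansion_delta (a r : K) n :
  expansion a r (fun x => (x - a) ^+ n) (delta_coef n).
Proof.
have h := expansion_shift _ _ n _ _ (expansion_cst a r 1).
apply: eq_expansion_coef h => [x _|k]; first by rewrite mulr1.
rewrite /delta_coef; have [kn|nk] := ltnP k n; first by rewrite ltn_eqF.
by rewrite ltnS leqn0 subn_eq0 eqn_leq nk andbT; case: ifP.
Qed.

Lemma is_derive_quadratic f x (l delta M : K) : 0 < delta -> 0 <= M ->
  (forall h, `|h| < delta -> `|f (x + h) - f x - h * l| <= M * `|h| ^+ 2) ->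
  is_derive x 1 f l.
Proof.
move=> d0 M0 fM.
have cf : h^-1 *: ((f \o shift x) (h *: 1) - f x) @[h --> 0^'] --> l.
  apply/cvgrPdist_le => eps e0; near=> h.
  have hn0 : h != 0 by near: h; exact: nbhs_dnbhs_neq.
  rewrite /= [h *: 1]mulr1 [h + x]addrC.
  have -> : l - h^-1 *: (f (x + h) - f x) = - (h^-1 * (f (x + h) - f x - h * l)).
    by rewrite mulrBr mulKf// opprB.
  rewrite normrN normrM normfV ler_pdivrMl ?normr_gt0//.
  have hd : `|h| < delta by near: h; apply: dnbhs0_lt.
  apply: le_trans (fM _ hd) _; rewrite expr2 mulrCA ler_wpM2l//.
  (* The denominator [M + 1] also covers [M = 0]. *)
  have h_eps : `|h| <= eps / (M + 1).
    by near: h; apply: dnbhs0_le; rewrite divr_gt0// ltr_wpDl.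
  apply: le_trans (ler_wpM2l M0 h_eps) _.
  by rewrite mulrCA -[leRHS]mulr1 ler_wpM2l ?(ltW e0)// ler_pdivrMr ?ltr_wpDl// mul1r lerDl.
by apply: DeriveDef; [apply/cvg_ex; exists l|exact: cvg_lim].
Unshelve. all: by end_near.
Qed.

Lemma expansion_is_derive a r f d : expansion a r f d ->
  forall x, 0 < `|x - a| < r -> exists2 l, is_derive x 1 f l &
    power_series_sum ((fun k => k%:R * d k) : nat -> K^o) (x - a) ((x - a) * l).
Proof.
move=> fd x xr; have dr := expansion_radius _ _ _ _ fd.
have /andP[x0 xr1] := xr.
have [s ds] := has_radius_sum _ _ _ (has_radius_deriv _ _ dr) xr1.
have [rho [M [rho0 /andP[xrho rhor] M0 H]]] := power_series_derivative _ _ _ _ xr dr ds.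
exists (s / (x - a)); last by rewrite mulrC divfK// -normr_gt0.
have rx0 : 0 < rho - `|x - a| by rewrite subr_gt0.
(* This [delta] is at most both [|x - a|], which keeps [x + h] away from [a], and [rho - |x - a|],
   which keeps it in the disc of radius [rho]. *)
apply: (@is_derive_quadratic _ _ _ (`|x - a| * (rho - `|x - a|) / rho) M) => //.
  by rewrite divr_gt0// mulr_gt0.
move=> h hd; have hx : `|h| < `|x - a|.
  apply: lt_le_trans hd _; rewrite ler_pdivrMr// ler_wpM2l//.
  by rewrite lerBlDr lerDl.
have hrho : `|x - a + h| <= rho.
  apply: le_trans (ler_normD _ _) _; rewrite -lerBrDl.
  apply: le_trans (ltW hd) _; rewrite mulrAC ler_piMl ?(ltW rx0)//.
  by rewrite ler_pdivrMr// mul1r ltW.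
apply: (H _ _ _ hrho (fd _ xr)).
have xh : x + h - a = x - a + h by rewrite addrAC.
rewrite -xh; apply: fd; rewrite xh (le_lt_trans hrho)// andbT normr_gt0 addr_eq0.
by apply: contraTneq hx => ->; rewrite normrN ltxx.
Qed.

Lemma near_punctured_disc a r x : 0 < `|x - a| < r ->
  \forall y \near x, 0 < `|y - a| < r.
Proof.
move=> /andP[x0 xr].
have rx0 : 0 < r - `|x - a| by rewrite subr_gt0.
apply: filterS2 (near_dist_lt x _ x0) (near_dist_lt x _ rx0) => y xy0 xyr.
apply/andP; split.
  rewrite normr_gt0; apply: contraTneq xy0 => /eqP; rewrite subr_eq0 => /eqP ->.
  by rewrite ltxx.
rewrite -(subrKA x); apply: le_lt_trans (ler_normD _ _) _.
by rewrite -ltrBrDr distrC.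
Qed.

(** With [z = x - a], one has [z^(n+1) f' = z (z^n f)' - n z^n f], and [z d/dz] multiplies the
    coefficient of index [k] by [k]. Poles of [f] are thus handled without Laurent series. *)
Lemma expansion_euler a r n f d :
  expansion a r (fun x => (x - a) ^+ n * f x) d ->
  expansion a r (fun x => (x - a) ^+ n.+1 * f^`()%classic x)
                (fun k => (k%:R - n%:R) * d k).
Proof.
move=> fd x xr; have [l gl ds] := expansion_is_derive _ _ _ _ fd _ xr.
have /andP[x0 _] := xr; have z0 : x - a != 0 by rewrite -normr_gt0.
have xa : x != a by rewrite -subr_eq0.
have := is_deriveM gl (is_derive_invX _ _ n xa).
have fE : \forall y \near x,
    ((fun y => (y - a) ^+ n * f y) * (fun y : K => (y - a) ^- n)) y = f y.
  apply: filterS (near_punctured_disc _ _ _ xr) => y /andP[y0 _].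
  have yn0 : (y - a) ^+ n != 0 by rewrite expf_neq0// -normr_gt0.
  by rewrite -[LHS]/((y - a) ^+ n * f y * (y - a) ^- n) mulrC mulKf.
move=> /(near_eq_is_derive fE) df.
rewrite derive1E derive_val.
have -> : (x - a) ^+ n.+1 *
  (((x - a) ^+ n * f x) *: (- (n%:R * (x - a) ^- n.+1)) + (x - a) ^- n *: l) =
  (x - a) * l + (- n%:R) * ((x - a) ^+ n * f x).
  by rewrite !scale_regularE exprS; field; rewrite ?expf_neq0.
have -> : (fun k => (k%:R - n%:R) * d k) = (fun k => k%:R * d k + - n%:R * d k).
  by apply/funext => k; rewrite mulrDl.
apply: (@power_series_sumD K^o) ds _.
exact: (expansionZ _ _ (- n%:R) _ _ fd _ xr).
Qed.

End Expansions.

(* Proves [expansion _ _ f ?d] by following the syntax of [f]. *)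
Ltac expand leaf := first [ leaf | lazymatch goal with
  | |- expansion _ _ (fun x => @?F x - @?G x) _ => refine (expansionB _ _ F G _ _ _ _)
  | |- expansion _ _ (fun x => @?F x + @?G x) _ => refine (expansionD _ _ F G _ _ _ _)
  | |- expansion _ _ (fun x => (x - _) ^+ ?n * @?F x) _ => refine (expansion_shift _ _ n F _ _)
  | |- expansion _ _ (fun x => @?F x * @?G x) _ =>
      lazymatch F with
      | fun=> ?b => refine (expansionZ _ _ b G _ _)
      | _ => refine (expansionM _ _ F G _ _ _ _)
      end
  | |- expansion _ _ (fun x => (x - _) ^+ ?n) _ => refine (expansion_delta _ _ n)
  end; expand leaf ].

(** * The gauge transformation *)

Section Mx2.
Context {K : numClosedFieldType}.

Lemma mx2M (a b c d a' b' c' d' : K) : mx2 a b c d *m mx2 a' b' c' d' =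
  mx2 (a * a' + b * c') (a * b' + b * d') (c * a' + d * c') (c * b' + d * d').
Proof.
apply/matrixP => i j; rewrite !mxE !big_ord_recl big_ord0 addr0 !mxE /=.
by case: (i == 0); case: (j == 0).
Qed.

Lemma mx2D (a b c d a' b' c' d' : K) : mx2 a b c d + mx2 a' b' c' d' =
  mx2 (a + a') (b + b') (c + c') (d + d').
Proof. by apply/matrixP => i j; rewrite !mxE; case: (i == 0); case: (j == 0). Qed.

Lemma mx2N (a b c d : K) : - mx2 a b c d = mx2 (- a) (- b) (- c) (- d).
Proof. by apply/matrixP => i j; rewrite !mxE; case: (i == 0); case: (j == 0). Qed.

Lemma mx2Z (e a b c d : K) : e *: mx2 a b c d = mx2 (e * a) (e * b) (e * c) (e * d).
Proof. by apply/matrixP => i j; rewrite !mxE; case: (i == 0); case: (j == 0). Qed.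

Lemma mx2_1 : 1%:M = mx2 1 0 0 1 :> 'M[K]_2.
Proof.
by apply/matrixP => i j; rewrite !mxE; case: i => [[|[|?]] ?]; case: j => [[|[|?]] ?].
Qed.

Lemma mx2_sum (a b c d : K) : mx2 a b c d =
  a *: mx2 1 0 0 0 + b *: mx2 0 1 0 0 + c *: mx2 0 0 1 0 + d *: mx2 0 0 0 1.
Proof. by rewrite !mx2Z !mx2D !mulr1 !mulr0 !addr0 !add0r. Qed.

Lemma invmx_mx2 (a b c d : K) : a * d - b * c = 1 ->
  invmx (mx2 a b c d) = mx2 d (- b) (- c) a.
Proof.
move=> det1; have e : mx2 a b c d *m mx2 d (- b) (- c) a = 1%:M.
  by rewrite mx2M mx2_1 -det1; congr mx2; ring.
have [u _] := mulmx1_unit e.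
by rewrite -[LHS]mulmx1 -e mulmxA mulVmx// mul1mx.
Qed.

Definition gauge_rat (z m : K) : 'M[K]_2 :=
  mx2 (z^-1 ^+ 2 + m / 2) (z^-1 - m * z / 2)
      (m^-1 * z^-1 / 2 - z / 4) (m^-1 / 2 + z ^+ 2 / 4).

(** The two branches enter each entry of the product only through their squares, so the choice of
    branch does not affect the result. *)
Lemma gauge_matrix_rat (a : K -> K) (gl gx : K -> K -> K -> K) (l x t m : K) :
  gl l x t ^+ 2 = m -> gx l x t ^+ 2 = x - a t -> m != 0 -> x != a t ->
  gauge_matrix a gl gx l x t = gauge_rat (x - a t) m.
Proof.
move=> qE pE m0 xa; have z0 : x - a t != 0 by rewrite subr_eq0.
rewrite /gauge_matrix; move: (gl l x t) (gx l x t) qE pE => q p qE pE.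
rewrite -pE -qE in z0 m0 *.
have q0 : q != 0 by rewrite -sqrf_eq0.
have p0 : p != 0 by rewrite -sqrf_eq0.
have s0 : sqrtC 2 != 0 :> K by rewrite sqrtC_eq0.
have s2 : sqrtC 2 ^+ 2 = 2 :> K by rewrite sqrtCK.
rewrite /sigma3_power /sigma3 /sigma1 !mx2D !mx2Z !mx2M /gauge_rat.
move: (sqrtC 2) s0 s2 => s s0 s2.
(* Writing [2] and [4] through [s = sqrtC 2] turns the entries into rational identities in [p], [q]
   and [s]. *)
have s4 : 4 = s ^+ 2 * s ^+ 2 by rewrite s2; ring.
by congr mx2; rewrite ?s4 -?s2; field; rewrite ?q0 ?p0 ?s0.
Qed.

Lemma invmx_gauge_rat (z m : K) : z != 0 -> m != 0 ->
  invmx (gauge_rat z m) =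
  mx2 (m^-1 / 2 + z ^+ 2 / 4) (- (z^-1 - m * z / 2))
      (- (m^-1 * z^-1 / 2 - z / 4)) (z^-1 ^+ 2 + m / 2).
Proof. by move=> z0 m0; rewrite invmx_mx2//; field; rewrite ?z0 ?m0. Qed.

(** Derivative of [gauge_rat] along a curve with velocities [dz] and [dm]. One formula serves three
    times: [(dz, dm)] is [(0, 1)] for [l], [(1, 0)] for [x], and [(- a', - 2 c0')] for [t]. *)
Definition gauge_rat_derive (z m dz dm : K) : 'M[K]_2 :=
  mx2 (- 2 * z^-1 ^+ 3 * dz + dm / 2) (- z^-1 ^+ 2 * dz - (m * dz + dm * z) / 2)
      (- (m^-1 ^+ 2 * z^-1 * dm + m^-1 * z^-1 ^+ 2 * dz) / 2 - dz / 4)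
      (- m^-1 ^+ 2 * dm / 2 + z * dz / 2).

(* [z^7 * 2 m], [z^8] and [z^6 * 4 m^2] times the entries of the transformed
   connection, see [gauge_rat_conj]. *)
Definition gauged11 (z m dz dm P Q S : K) :=
  (2 + m ^+ 2 * z ^+ 4 / 2) * P + (1 - m ^+ 2 * z ^+ 4 / 4) * (S - Q)
  - dz * z ^+ 4 * (1 + m * z ^+ 2 / 2) ^+ 2 + dm * z ^+ 7.

Definition gauged12 (z m dz dm P Q S : K) :=
  (1 + m * z ^+ 2 / 2) ^+ 2 * Q - (1 - m * z ^+ 2 / 2) ^+ 2 * S
  - 2 * (1 - m ^+ 2 * z ^+ 4 / 4) * P
  + dz * z ^+ 4 * (1 - 2 * m * z ^+ 2 - m ^+ 2 * z ^+ 4 / 4) - dm * z ^+ 7.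

Definition gauged21 (z m dz dm P Q S : K) :=
  (1 + m * z ^+ 2 / 2) ^+ 2 * S - (1 - m * z ^+ 2 / 2) ^+ 2 * Q
  + 2 * (1 - m ^+ 2 * z ^+ 4 / 4) * P
  - dz * z ^+ 4 * (1 + 2 * m * z ^+ 2 - m ^+ 2 * z ^+ 4 / 4) - dm * z ^+ 7.

(** The result stays traceless, since conjugation preserves the trace and [gauge_rat] has
    determinant [1]; this is why the last entry is the negative of the first. *)
Lemma gauge_rat_conj (z m dz dm p q s : K) : z != 0 -> m != 0 ->
  gauge_rat z m *m mx2 p q s (- p) *m invmx (gauge_rat z m)
  + gauge_rat_derive z m dz dm *m invmx (gauge_rat z m) =
  let P := z ^+ 5 * p in let Q := z ^+ 4 * q in let S := z ^+ 6 * s in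
  mx2 ((2 * m)^-1 * (gauged11 z m dz dm P Q S / z ^+ 7)) (gauged12 z m dz dm P Q S / z ^+ 8)
      ((4 * m ^+ 2)^-1 * (gauged21 z m dz dm P Q S / z ^+ 6))
      (- (2 * m)^-1 * (gauged11 z m dz dm P Q S / z ^+ 7)).
Proof.
move=> z0 m0; rewrite invmx_gauge_rat// /gauge_rat /gauge_rat_derive !mx2M mx2D.
by congr mx2; rewrite /gauged11 /gauged12 /gauged21; field; rewrite ?z0 ?m0.
Qed.

End Mx2.

(** * Derivative of the rational gauge matrix *)

Section GaugeDerive.
Context {K : numClosedFieldType}.

Lemma is_derive_mx2 (f1 f2 f3 f4 : K -> K) (x l1 l2 l3 l4 : K) :
  is_derive x 1 f1 l1 -> is_derive x 1 f2 l2 ->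
  is_derive x 1 f3 l3 -> is_derive x 1 f4 l4 ->
  is_derive x 1 (fun y => mx2 (f1 y) (f2 y) (f3 y) (f4 y)) (mx2 l1 l2 l3 l4).
Proof.
move=> d1 d2 d3 d4; rewrite mx2_sum; under eq_fun do rewrite mx2_sum.
by apply: is_deriveD; [apply: is_deriveD; [apply: is_deriveD|]|]; exact: is_deriveZr.
Qed.

Lemma is_derive_gauge_rat (zf mf : K -> K) (x dz dm : K) :
  is_derive x 1 zf dz -> is_derive x 1 mf dm -> zf x != 0 -> mf x != 0 ->
  is_derive x 1 (fun y => gauge_rat (zf y) (mf y))
    (gauge_rat_derive (zf x) (mf x) dz dm).
Proof.
move=> Dz Dm z0 m0; have Dw := is_derive_inv _ _ _ z0 Dz.
have Dv := is_derive_inv _ _ _ m0 Dm.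
have Dc (b : K) := is_derive_cst b x (1 : K).
apply: is_derive_mx2.
- apply: (is_derive_eq (is_deriveD (is_deriveX 2 Dw) (is_deriveM Dm (Dc 2^-1)))).
  by rewrite !scale_regularE /=; ring.
- apply: (is_derive_eq (is_deriveB Dw (is_deriveM (is_deriveM Dm Dz) (Dc 2^-1)))).
  by rewrite !scale_regularE /=; ring.
- apply: (is_derive_eq (is_deriveB (is_deriveM (is_deriveM Dv Dw) (Dc 2^-1))
    (is_deriveM Dz (Dc 4^-1)))).
  by rewrite !scale_regularE /=; ring.
- apply: (is_derive_eq (is_deriveD (is_deriveM Dv (Dc 2^-1))
    (is_deriveM (is_deriveX 2 Dz) (Dc 4^-1)))).
  by rewrite !scale_regularE /=; field.
Qed.

End GaugeDerive.

Section GaugedCoefficients.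
Context {K : fieldType}.
Variables (m dz dm : K) (P Q S : nat -> K).

(** In this and the next two definitions the squares of [gauged11], [gauged12], [gauged21] are
    expanded, and powers of [z] become shifts or delta sequences, so that each coefficient computes
    at a numeral [k]. *)
Definition gauged_coef11 (k : nat) : K :=
  2 * P k + m ^+ 2 / 2 * shift_coef 4 P k
  + (S k - Q k) - m ^+ 2 / 4 * (shift_coef 4 S k - shift_coef 4 Q k)
  - dz * (delta_coef 4 k + m * delta_coef 6 k + m ^+ 2 / 4 * delta_coef 8 k)
  + dm * delta_coef 7 k.

Definition gauged_coef12 (k : nat) : K :=
  Q k + m * shift_coef 2 Q k + m ^+ 2 / 4 * shift_coef 4 Q k
  - (S k - m * shift_coef 2 S k + m ^+ 2 / 4 * shift_coef 4 S k)
  - 2 * (P k - m ^+ 2 / 4 * shift_coef 4 P k)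
  + dz * (delta_coef 4 k - 2 * m * delta_coef 6 k - m ^+ 2 / 4 * delta_coef 8 k)
  - dm * delta_coef 7 k.

Definition gauged_coef21 (k : nat) : K :=
  S k + m * shift_coef 2 S k + m ^+ 2 / 4 * shift_coef 4 S k
  - (Q k - m * shift_coef 2 Q k + m ^+ 2 / 4 * shift_coef 4 Q k)
  + 2 * (P k - m ^+ 2 / 4 * shift_coef 4 P k)
  - dz * (delta_coef 4 k + 2 * m * delta_coef 6 k - m ^+ 2 / 4 * delta_coef 8 k)
  - dm * delta_coef 7 k.

End GaugedCoefficients.

Section Regularity.
Context {R : realType}.
Local Notation K := (Cplx R).

Lemma power_series_sum_mx2 (d1 d2 d3 d4 : nat -> K) (z s1 s2 s3 s4 : K) :
  power_series_sum (d1 : nat -> K^o) z s1 -> power_series_sum (d2 : nat -> K^o) z s2 ->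
  power_series_sum (d3 : nat -> K^o) z s3 -> power_series_sum (d4 : nat -> K^o) z s4 ->
  power_series_sum (fun k => mx2 (d1 k) (d2 k) (d3 k) (d4 k)) z (mx2 s1 s2 s3 s4).
Proof.
move=> h1 h2 h3 h4; rewrite mx2_sum (funext (fun k => mx2_sum _ _ _ _)).
do 3 (apply: power_series_sumD; last exact: power_series_sumZr).
exact: power_series_sumZr.
Qed.

Section Reduced.
Variables (a r m dz dm : K) (p q s : K -> K) (P Q S : nat -> K).
Hypotheses (pP : expansion a r p P) (qQ : expansion a r q Q) (sS : expansion a r s S).

Ltac leaf := idtac; lazymatch goal with
  H : expansion _ _ ?F _ |- expansion _ _ (fun x => ?F x) _ => refine H end.

Lemma expansion_gauged11 :
  expansion a r (fun x => gauged11 (x - a) m dz dm (p x) (q x) (s x))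
    (gauged_coef11 m dz dm P Q S).
Proof.
(* The terms are arranged so that the coefficients built by [expand] are convertible to
   [gauged_coef11]. *)
apply: (@eq_expansion_coef _ _ _ (fun x => 2 * p x + m ^+ 2 / 2 * ((x - a) ^+ 4 * p x)
  + (s x - q x) - m ^+ 2 / 4 * ((x - a) ^+ 4 * s x - (x - a) ^+ 4 * q x)
  - dz * ((x - a) ^+ 4 + m * (x - a) ^+ 6 + m ^+ 2 / 4 * (x - a) ^+ 8)
  + dm * (x - a) ^+ 7)); last by expand leaf.
  by move=> x _; rewrite /gauged11; field.
by [].
Qed.

Lemma expansion_gauged12 :
  expansion a r (fun x => gauged12 (x - a) m dz dm (p x) (q x) (s x))
    (gauged_coef12 m dz dm P Q S).
Proof.
apply: (@eq_expansion_coef _ _ _ (fun x =>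
  q x + m * ((x - a) ^+ 2 * q x) + m ^+ 2 / 4 * ((x - a) ^+ 4 * q x)
  - (s x - m * ((x - a) ^+ 2 * s x) + m ^+ 2 / 4 * ((x - a) ^+ 4 * s x))
  - 2 * (p x - m ^+ 2 / 4 * ((x - a) ^+ 4 * p x))
  + dz * ((x - a) ^+ 4 - 2 * m * (x - a) ^+ 6 - m ^+ 2 / 4 * (x - a) ^+ 8)
  - dm * (x - a) ^+ 7)); last by expand leaf.
  by move=> x _; rewrite /gauged12; field.
by [].
Qed.

Lemma expansion_gauged21 :
  expansion a r (fun x => gauged21 (x - a) m dz dm (p x) (q x) (s x))
    (gauged_coef21 m dz dm P Q S).
Proof.
apply: (@eq_expansion_coef _ _ _ (fun x =>
  s x + m * ((x - a) ^+ 2 * s x) + m ^+ 2 / 4 * ((x - a) ^+ 4 * s x)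
  - (q x - m * ((x - a) ^+ 2 * q x) + m ^+ 2 / 4 * ((x - a) ^+ 4 * q x))
  + 2 * (p x - m ^+ 2 / 4 * ((x - a) ^+ 4 * p x))
  - dz * ((x - a) ^+ 4 + 2 * m * (x - a) ^+ 6 - m ^+ 2 / 4 * (x - a) ^+ 8)
  - dm * (x - a) ^+ 7)); last by expand leaf.
  by move=> x _; rewrite /gauged21; field.
by [].
Qed.

End Reduced.

Lemma gauge_regular (a r m dz dm : K) (p q s : K -> K) (P Q S : nat -> K) :
  m != 0 ->
  expansion a r (fun x => (x - a) ^+ 5 * p x) P ->
  expansion a r (fun x => (x - a) ^+ 4 * q x) Q ->
  expansion a r (fun x => (x - a) ^+ 6 * s x) S ->
  (forall k, (k < 7)%N -> gauged_coef11 m dz dm P Q S k = 0) ->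
  (forall k, (k < 8)%N -> gauged_coef12 m dz dm P Q S k = 0) ->
  (forall k, (k < 6)%N -> gauged_coef21 m dz dm P Q S k = 0) ->
  exists d : nat -> 'M[K]_2, forall x, 0 < `|x - a| < r ->
    power_series_sum d (x - a)
      (gauge_rat (x - a) m *m mx2 (p x) (q x) (s x) (- p x) *m invmx (gauge_rat (x - a) m)
       + gauge_rat_derive (x - a) m dz dm *m invmx (gauge_rat (x - a) m)).
Proof.
move=> m0 pP qQ sS h11 h12 h21.
have e11 := expansion_div _ _ _ _ _ (expansion_gauged11 _ _ m dz dm _ _ _ _ _ _ pP qQ sS) h11.
have e12 := expansion_div _ _ _ _ _ (expansion_gauged12 _ _ m dz dm _ _ _ _ _ _ pP qQ sS) h12.
have e21 := expansion_div _ _ _ _ _ (expansion_gauged21 _ _ m dz dm _ _ _ _ _ _ pP qQ sS) h21.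
eexists => x xr; have z0 : x - a != 0 by case/andP: xr => z0 _; rewrite -normr_gt0.
rewrite gauge_rat_conj//=.
apply: power_series_sum_mx2.
- exact: (expansionZ _ _ _ _ _ e11 _ xr).
- exact: (e12 _ xr).
- exact: (expansionZ _ _ _ _ _ e21 _ xr).
- exact: (expansionZ _ _ _ _ _ e11 _ xr).
Qed.

End Regularity.

(** * The Laurent series of the solution *)

(* [convolution d e k] in a form that reduces for a numeral [k]. *)
Fixpoint convolution_rec {K : pzRingType} (d e : nat -> K) (i j : nat) : K :=
  if j is j'.+1 then d i * e j + convolution_rec d e i.+1 j' else d i * e 0%N.

Lemma convolution_recE {R : realType} :
  @convolution R = fun d e k => convolution_rec d e 0 k.
Proof.
apply/funext => d; apply/funext => e; apply/funext => k.
suff H j i : convolution_rec d e i j = \sum_(n < j.+1) d (i + n)%N * e (j - n)%N.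
  by rewrite H.
elim: j i => [|j IHj] i; first by rewrite big_ord1 addn0.
rewrite big_ord_recl addn0 subn0 /= IHj; congr (_ + _).
by apply: eq_bigr => n _; rewrite addnS addSn.
Qed.

Section LaurentCoefficients.
Context {R : realType}.
Local Notation K := (Cplx R).
Variables (a t : K) (c : nat -> K).

(* Coefficients of [(x - a)^(n + 2) u^(n)(x)]; those of index [k.+2] involve [c k]. *)
Fixpoint laurent_coef (n k : nat) : K :=
  if n is n'.+1 then (k%:R - n'.+2%:R) * laurent_coef n' k
  else if k is k'.+2 then c k' else if k is 0%N then -1 else 0.

Local Notation y := laurent_coef.

(** The coefficient [c k] first appears at index [k.+2], with the factor
    [k (k - 3) (k + 3) (k - 6)]. It vanishes at [0], [3] and [6], so [c 0], [c 3] and [c 6] remain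
    free. *)
Definition PI2_coef (k : nat) : K :=
  y 4 k + 10 * convolution (y 1) (y 1) k + 20 * convolution (y 0) (y 2) k
  + 40 * (convolution (y 0) (convolution (y 0) (y 0)) k
          - 6 * t * shift_coef 4 (y 0) k
          + 6 * (a * delta_coef 6 k + delta_coef 7 k)).

Ltac expand_coef := rewrite /PI2_coef convolution_recE /shift_coef /delta_coef /=
  ?(subSS, subn0) /=.

(* The constants 40, -56, -80 are the factors of [c 1], [c 2], [c 4], [c 5] in the
   coefficients 3, 4, 6, 7 of [(x - a)^6] times the equation. *)
Lemma laurent_recursion : (forall k, PI2_coef k = 0) ->
  [/\ c 1%N = 0, c 2%N = 3 * (c 0%N ^+ 2 - 2 * t),
      c 4%N = 30 / 7 * a - 10 * c 0%N ^+ 3 + 120 / 7 * c 0%N * t &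
      c 5%N = 3 - 3 / 2 * c 0%N * c 3%N].
Proof.
move=> h.
have c1 : c 1%N = 0.
  have : c 1%N = PI2_coef 3 / 40 by expand_coef; field.
  by rewrite h mul0r.
have c2 : c 2%N = 3 * (c 0%N ^+ 2 - 2 * t).
  have : c 2%N = 3 * (c 0%N ^+ 2 - 2 * t) + PI2_coef 4 / 40.
    by expand_coef; rewrite c1; field.
  by rewrite h mul0r addr0.
split => //.
  have : c 4%N = 30 / 7 * a - 10 * c 0%N ^+ 3 + 120 / 7 * c 0%N * t - PI2_coef 6 / 56.
    by expand_coef; rewrite c1 c2; field.
  by rewrite h mul0r subr0.
have : c 5%N = 3 - 3 / 2 * c 0%N * c 3%N - PI2_coef 7 / 80.
  by expand_coef; rewrite c1 c2; field.
by rewrite h mul0r subr0.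
Qed.

Definition connA_coef11 (l : K) (k : nat) : K := 240^-1 *
  (- 4 * l * shift_coef 2 (y 1) k - (12 * convolution (y 0) (y 1) k + y 3 k)).

Definition connA_coef12 (l : K) (k : nat) : K := 240^-1 *
  (8 * l ^+ 2 * delta_coef 4 k + 8 * l * shift_coef 2 (y 0) k
   + (12 * convolution (y 0) (y 0) k + 2 * y 2 k - 120 * t * delta_coef 4 k)).

Definition connA_coef21 (l : K) (k : nat) : K := 240^-1 *
  (8 * l ^+ 3 * delta_coef 6 k - 8 * l ^+ 2 * shift_coef 4 (y 0) k
   - (4 * l * shift_coef 2 (convolution (y 0) (y 0)) k + 2 * l * shift_coef 2 (y 2) k
      + 120 * t * l * delta_coef 6 k)
   + (16 * convolution (y 0) (convolution (y 0) (y 0)) k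
      - 2 * convolution (y 1) (y 1) k + 4 * convolution (y 0) (y 2) k
      + 240 * (a * delta_coef 6 k + delta_coef 7 k))).

Definition connB_coef21 (l : K) (k : nat) : K :=
  l * delta_coef 6 k - 2 * shift_coef 4 (y 0) k.

Definition connC_coef11 (k : nat) : K := 6^-1 * shift_coef 2 (y 1) k.

Definition connC_coef12 (l : K) (k : nat) : K :=
  - 3^-1 * (l * delta_coef 4 k + shift_coef 2 (y 0) k).

Definition connC_coef21 (l : K) (k : nat) : K := - 3^-1 *
  (l ^+ 2 * delta_coef 6 k - l * shift_coef 4 (y 0) k
   - 2 * shift_coef 2 (convolution (y 0) (y 0)) k - 2^-1 * shift_coef 2 (y 2) k).

Hypotheses (c1 : c 1%N = 0) (c2 : c 2%N = 3 * (c 0%N ^+ 2 - 2 * t))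
  (c4 : c 4%N = 30 / 7 * a - 10 * c 0%N ^+ 3 + 120 / 7 * c 0%N * t)
  (c5 : c 5%N = 3 - 3 / 2 * c 0%N * c 3%N).

Ltac vanish := rewrite /gauged_coef11 /gauged_coef12 /gauged_coef21
  /connA_coef11 /connA_coef12 /connA_coef21 /connB_coef21 /connC_coef11
  /connC_coef12 /connC_coef21 ?convolution_recE /shift_coef /delta_coef /=
  ?(subSS, subn0) /= ?(c1, c2, c4, c5).

(** With [l = m + 2 c0] each case is a polynomial identity in [m]. Indices below [8] involve at most
    [c 0] to [c 5], and the recursion leaves only [c 0] and [c 3] among these. *)
Lemma connA_vanish11 (m : K) k : (k < 7)%N ->
  gauged_coef11 m 0 1 (connA_coef11 (m + 2 * c 0%N)) (connA_coef12 (m + 2 * c 0%N))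
    (connA_coef21 (m + 2 * c 0%N)) k = 0.
Proof. by do 7 (case: k => [|k]; [by move=> _; vanish; field|]). Qed.

Lemma connA_vanish12 (m : K) k : (k < 8)%N ->
  gauged_coef12 m 0 1 (connA_coef11 (m + 2 * c 0%N)) (connA_coef12 (m + 2 * c 0%N))
    (connA_coef21 (m + 2 * c 0%N)) k = 0.
Proof. by do 8 (case: k => [|k]; [by move=> _; vanish; field|]). Qed.

Lemma connA_vanish21 (m : K) k : (k < 6)%N ->
  gauged_coef21 m 0 1 (connA_coef11 (m + 2 * c 0%N)) (connA_coef12 (m + 2 * c 0%N))
    (connA_coef21 (m + 2 * c 0%N)) k = 0.
Proof. by do 6 (case: k => [|k]; [by move=> _; vanish; field|]). Qed.

Lemma connB_vanish11 (m : K) k : (k < 7)%N ->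
  gauged_coef11 m 1 0 (fun=> 0) (delta_coef 4)
    (connB_coef21 (m + 2 * c 0%N)) k = 0.
Proof. by do 7 (case: k => [|k]; [by move=> _; vanish; field|]). Qed.

Lemma connB_vanish12 (m : K) k : (k < 8)%N ->
  gauged_coef12 m 1 0 (fun=> 0) (delta_coef 4)
    (connB_coef21 (m + 2 * c 0%N)) k = 0.
Proof. by do 8 (case: k => [|k]; [by move=> _; vanish; field|]). Qed.

Lemma connB_vanish21 (m : K) k : (k < 6)%N ->
  gauged_coef21 m 1 0 (fun=> 0) (delta_coef 4)
    (connB_coef21 (m + 2 * c 0%N)) k = 0.
Proof. by do 6 (case: k => [|k]; [by move=> _; vanish; field|]). Qed.

(** The velocities [- c 0] and [- c 3] are the [t]-derivatives of [x - a] and [l - 2 c0] once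
    [a' = c0] and [2 c0' = c3]. *)
Lemma connC_vanish11 (m : K) k : (k < 7)%N ->
  gauged_coef11 m (- c 0%N) (- c 3%N) connC_coef11 (connC_coef12 (m + 2 * c 0%N))
    (connC_coef21 (m + 2 * c 0%N)) k = 0.
Proof. by do 7 (case: k => [|k]; [by move=> _; vanish; field|]). Qed.

Lemma connC_vanish12 (m : K) k : (k < 8)%N ->
  gauged_coef12 m (- c 0%N) (- c 3%N) connC_coef11 (connC_coef12 (m + 2 * c 0%N))
    (connC_coef21 (m + 2 * c 0%N)) k = 0.
Proof. by do 8 (case: k => [|k]; [by move=> _; vanish; field|]). Qed.

Lemma connC_vanish21 (m : K) k : (k < 6)%N ->
  gauged_coef21 m (- c 0%N) (- c 3%N) connC_coef11 (connC_coef12 (m + 2 * c 0%N))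
    (connC_coef21 (m + 2 * c 0%N)) k = 0.
Proof. by do 6 (case: k => [|k]; [by move=> _; vanish; field|]). Qed.

End LaurentCoefficients.

(** * Expansions of the solution at a fixed [t], and regularity of the three connections *)

Section Laurent.
Context {R : realType}.
Local Notation K := (Cplx R).
Variables (u : K -> K -> K) (t a r : K) (c : nat -> K).
Hypothesis r_gt0 : 0 < r.
Hypothesis u_laurent : forall x, 0 < `|x - a| < r ->
  exists2 s : K^o, power_series_sum (c : nat -> K^o) (x - a) s & u x t = - (x - a) ^- 2 + s.
Hypothesis u_PI2 : forall x, 0 < `|x - a| < r -> solves_PI2_at u x t.

Local Notation y n := (fun x => (x - a) ^+ n.+2 * dx u n x t).

(** Each derivative costs one application of [expansion_euler]. The base case puts the pole back:
    [(x - a)^2 u] is [-1] plus [(x - a)^2] times the regular part [v]. *)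
Lemma expansion_laurent n : expansion a r (y n) (laurent_coef c n).
Proof.
elim: n => [|n IHn].
  have v : expansion a r (fun x => u x t + (x - a) ^- 2) c.
    by move=> x /u_laurent[s sc ->]; rewrite addrAC addNr add0r.
  have := expansionD _ _ _ _ _ _ (expansionZ _ _ (-1) _ _ (expansion_delta a r 0))
    (expansion_shift _ _ 2 _ _ v).
  apply: eq_expansion_coef => [x /andP[x0 _]|[|[|k]]].
  - have z0 : x - a != 0 by rewrite -normr_gt0.
    by rewrite /dx /= expr0; field.
  - by rewrite /delta_coef /= addr0 mulr1.
  - by rewrite /delta_coef /= mulr0 addr0.
  - by rewrite /delta_coef /= mulr0 add0r subSS subSS subn0.
apply: eq_expansion (expansion_euler _ _ _ _ _ IHn) => x _.
by rewrite /dx derive1nS.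
Qed.

Lemma expansion_laurent0 : expansion a r (fun x => (x - a) ^+ 2 * u x t) (laurent_coef c 0).
Proof. exact: expansion_laurent 0. Qed.

Lemma expansion_center : expansion a r (fun x => (x - a) ^+ 6 * x)
  (fun k => a * delta_coef 6 k + delta_coef 7 k).
Proof.
have := expansionD _ _ _ _ _ _ (expansionZ _ _ a _ _ (expansion_delta a r 6))
  (expansion_delta a r 7).
by apply: eq_expansion => x _; ring.
Qed.

(* [ring] would compare distinct derivatives by unfolding them. *)
Ltac generalize_dx := repeat match goal with |- context [dx u ?n ?x t] =>
  generalize (dx u n x t); intro end.

Ltac leaf := idtac; lazymatch goal with
  | |- expansion _ _ (fun x => (x - _) ^+ _ * x) _ => refine expansion_center
  | |- expansion _ _ (fun x => (x - _) ^+ _ * u x t) _ => refine expansion_laurent0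
  | |- expansion _ _ (fun x => (x - _) ^+ _ * dx _ ?n x _) _ => refine (expansion_laurent n)
  end.

Local Notation D0 x := ((x - a) ^+ 2 * u x t).
Local Notation D n x := ((x - a) ^+ n.+2 * dx u n x t).

Lemma PI2_coef_eq0 k : PI2_coef a t c k = 0.
Proof.
apply: (expansion_eq0 a r) k => //.
(* The factor [(x - a)^6] is distributed by pole order, as 6, 3 + 3, 2 + 4 and 2 + 2 + 2, so that
   every factor becomes a power series. *)
refine (@eq_expansion_coef _ a r (fun x => D 4 x + 10 * (D 1 x * D 1 x) + 20 * (D0 x * D 2 x)
  + 40 * (D0 x * (D0 x * D0 x) - 6 * t * ((x - a) ^+ 4 * D0 x)
          + 6 * ((x - a) ^+ 6 * x))) _ _ _ _ _ _).
  move=> x /u_PI2; rewrite /solves_PI2_at => e.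
  transitivity ((x - a) ^+ 6 * (dx u 4 x t + 10 * dx u 1 x t ^+ 2 + 20 * u x t * dx u 2 x t
    + 40 * (u x t ^+ 3 - 6 * t * u x t + 6 * x))); last by rewrite e mulr0.
  by generalize_dx; ring.
2: expand leaf.
by [].
Qed.

Lemma laurent_solution_recursion :
  [/\ c 1%N = 0, c 2%N = 3 * (c 0%N ^+ 2 - 2 * t),
      c 4%N = 30 / 7 * a - 10 * c 0%N ^+ 3 + 120 / 7 * c 0%N * t &
      c 5%N = 3 - 3 / 2 * c 0%N * c 3%N].
Proof. exact: laurent_recursion PI2_coef_eq0. Qed.

Local Notation U x := (u x t).
Local Notation U1 x := (dx u 1 x t).
Local Notation U2 x := (dx u 2 x t).
Local Notation U3 x := (dx u 3 x t).

Lemma connA_mx2 l x : connA u l x t =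
  let p := 240^-1 * (- 4 * U1 x * l - (12 * U x * U1 x + U3 x)) in
  mx2 p (240^-1 * (8 * l ^+ 2 + 8 * U x * l + (12 * U x ^+ 2 + 2 * U2 x - 120 * t)))
    (240^-1 * (8 * l ^+ 3 - 8 * U x * l ^+ 2 - (4 * U x ^+ 2 + 2 * U2 x + 120 * t) * l
       + (16 * U x ^+ 3 - 2 * U1 x ^+ 2 + 4 * U x * U2 x + 240 * x))) (- p).
Proof.
rewrite /connA; cbv zeta; generalize_dx.
by rewrite /sigma3 /sigma_plus /sigma_minus !(mx2Z, mx2D); congr mx2; ring.
Qed.

Lemma connB_mx2 l x : connB u l x t = mx2 0 1 (l - 2 * U x) (- 0).
Proof.
by rewrite /connB /sigma_plus /sigma_minus !(mx2Z, mx2D); congr mx2; generalize_dx; ring.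
Qed.

Lemma connC_mx2 l x : connC u l x t =
  mx2 (6^-1 * U1 x) (- 3^-1 * (l + U x))
    (- 3^-1 * (l ^+ 2 - U x * l - 2 * U x ^+ 2 - 2^-1 * U2 x)) (- (6^-1 * U1 x)).
Proof.
rewrite /connC; cbv zeta; generalize_dx.
by rewrite /sigma3 /sigma_plus /sigma_minus !(mx2Z, mx2N, mx2D); congr mx2; ring.
Qed.

Lemma connA_regular m : m != 0 -> exists d : nat -> 'M[K]_2, forall x, 0 < `|x - a| < r ->
  power_series_sum d (x - a)
    (gauge_rat (x - a) m *m connA u (m + 2 * c 0%N) x t *m invmx (gauge_rat (x - a) m)
     + gauge_rat_derive (x - a) m 0 1 *m invmx (gauge_rat (x - a) m)).
Proof.
move=> m0; set l := m + _; have [c1 c2 c4 c5] := laurent_solution_recursion.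
under eq_exists do under eq_forall do rewrite connA_mx2.
apply: (gauge_regular a r m 0 1 _ _ _ (connA_coef11 c l) (connA_coef12 t c l)
  (connA_coef21 a t c l)) => //.
- refine (@eq_expansion_coef _ a r (fun x => 240^-1 *
    (- 4 * l * ((x - a) ^+ 2 * D 1 x) - (12 * (D0 x * D 1 x) + D 3 x))) _ _ _ _ _ _).
  by move=> x _; generalize_dx; ring.
  2: expand leaf.
  by [].
- refine (@eq_expansion_coef _ a r (fun x => 240^-1 *
    (8 * l ^+ 2 * (x - a) ^+ 4 + 8 * l * ((x - a) ^+ 2 * D0 x)
     + (12 * (D0 x * D0 x) + 2 * D 2 x - 120 * t * (x - a) ^+ 4))) _ _ _ _ _ _).
  by move=> x _; generalize_dx; ring.
  2: expand leaf.
  by [].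
- refine (@eq_expansion_coef _ a r (fun x => 240^-1 *
    (8 * l ^+ 3 * (x - a) ^+ 6 - 8 * l ^+ 2 * ((x - a) ^+ 4 * D0 x)
     - (4 * l * ((x - a) ^+ 2 * (D0 x * D0 x)) + 2 * l * ((x - a) ^+ 2 * D 2 x)
        + 120 * t * l * (x - a) ^+ 6)
     + (16 * (D0 x * (D0 x * D0 x)) - 2 * (D 1 x * D 1 x) + 4 * (D0 x * D 2 x)
        + 240 * ((x - a) ^+ 6 * x)))) _ _ _ _ _ _).
  by move=> x _; generalize_dx; ring.
  2: expand leaf.
  by [].
- by move=> k; exact: connA_vanish11.
- by move=> k; exact: connA_vanish12.
- by move=> k; exact: connA_vanish21.
Qed.

Lemma connB_regular m : m != 0 -> exists d : nat -> 'M[K]_2, forall x, 0 < `|x - a| < r ->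
  power_series_sum d (x - a)
    (gauge_rat (x - a) m *m connB u (m + 2 * c 0%N) x t *m invmx (gauge_rat (x - a) m)
     + gauge_rat_derive (x - a) m 1 0 *m invmx (gauge_rat (x - a) m)).
Proof.
move=> m0; set l := m + _; have [c1 c2 c4 c5] := laurent_solution_recursion.
under eq_exists do under eq_forall do rewrite connB_mx2.
apply: (gauge_regular a r m 1 0 _ _ _ (fun=> 0) (delta_coef 4) (connB_coef21 c l)) => //.
(* The zero entry is written as a multiple of a monomial, a form that [expand] recognizes. *)
- refine (@eq_expansion_coef _ a r (fun x => 0 * (x - a) ^+ 0) _ _ _ _ _ _).
  by move=> x _; rewrite mul0r mulr0.
  2: expand leaf.
  by move=> k; rewrite mul0r.
- refine (@eq_expansion_coef _ a r (fun x => (x - a) ^+ 4) _ _ _ _ _ _).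
  by move=> x _; rewrite mulr1.
  2: expand leaf.
  by [].
- refine (@eq_expansion_coef _ a r (fun x => l * (x - a) ^+ 6 - 2 * ((x - a) ^+ 4 * D0 x))
    _ _ _ _ _ _).
  by move=> x _; ring.
  2: expand leaf.
  by [].
- by move=> k; exact: connB_vanish11.
- by move=> k; exact: connB_vanish12.
- by move=> k; exact: connB_vanish21.
Qed.

Lemma connC_regular m : m != 0 -> exists d : nat -> 'M[K]_2, forall x, 0 < `|x - a| < r ->
  power_series_sum d (x - a)
    (gauge_rat (x - a) m *m connC u (m + 2 * c 0%N) x t *m invmx (gauge_rat (x - a) m)
     + gauge_rat_derive (x - a) m (- c 0%N) (- c 3%N) *m invmx (gauge_rat (x - a) m)).
Proof.
move=> m0; set l := m + _; have [c1 c2 c4 c5] := laurent_solution_recursion.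
under eq_exists do under eq_forall do rewrite connC_mx2.
apply: (gauge_regular a r m _ _ _ _ _ (connC_coef11 c) (connC_coef12 c l)
  (connC_coef21 c l)) => //.
- refine (@eq_expansion_coef _ a r (fun x => 6^-1 * ((x - a) ^+ 2 * D 1 x)) _ _ _ _ _ _).
  by move=> x _; generalize_dx; ring.
  2: expand leaf.
  by [].
- refine (@eq_expansion_coef _ a r (fun x => - 3^-1 *
    (l * (x - a) ^+ 4 + (x - a) ^+ 2 * D0 x)) _ _ _ _ _ _).
  by move=> x _; ring.
  2: expand leaf.
  by [].
- refine (@eq_expansion_coef _ a r (fun x => - 3^-1 *
    (l ^+ 2 * (x - a) ^+ 6 - l * ((x - a) ^+ 4 * D0 x)
     - 2 * ((x - a) ^+ 2 * (D0 x * D0 x)) - 2^-1 * ((x - a) ^+ 2 * D 2 x))) _ _ _ _ _ _).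
  by move=> x _; generalize_dx; ring.
  2: expand leaf.
  by [].
- by move=> k; exact: (connC_vanish11 t).
- by move=> k; exact: (connC_vanish12 t).
- by move=> k; exact: connC_vanish21.
Qed.

End Laurent.

(** Differentiation only sees a neighbourhood of [x]. There [zf] and [mf] stay nonzero by
    continuity, so [F] agrees with the rational matrix even if it is built from discontinuous
    branches. *)
Lemma derive1_gauge_rat {K : numClosedFieldType} (F : K -> 'M[K]_2) (zf mf : K -> K)
    (x dz dm : K) :
  is_derive x 1 zf dz -> is_derive x 1 mf dm -> zf x != 0 -> mf x != 0 ->
  (forall y, zf y != 0 -> mf y != 0 -> F y = gauge_rat (zf y) (mf y)) ->
  F^`()%classic x = gauge_rat_derive (zf x) (mf x) dz dm.
Proof.
move=> Dz Dm z0 m0 FE.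
have nz (f : K -> K) l : is_derive x 1 f l -> f x != 0 -> \forall y \near x, f y != 0.
  move=> [df _] f0; have /derivable1_diffP/differentiable_continuous := df.
  move=> /cvgr_dist_lt /(_ `|f x|); rewrite normr_gt0 => /(_ f0).
  apply: filterS => y; apply: contraTneq => ->.
  by rewrite subr0 ltxx.
rewrite derive1E; have D := is_derive_gauge_rat _ _ _ _ _ Dz Dm z0 m0.
rewrite -(@derive_val _ _ _ _ _ _ _ D); apply: near_eq_derive.
apply: filterS2 (nz _ _ Dz z0) (nz _ _ Dm m0) => y; exact: FE.
Qed.

(** * From the reduced rational gauge back to the given gauge matrix *)

Theorem theorem3p1 (R : realType) (D : set (Cplx R))
    (u : Cplx R -> Cplx R -> Cplx R)
    (a : Cplx R -> Cplx R) (c : nat -> Cplx R -> Cplx R)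
    (gl gx : Cplx R -> Cplx R -> Cplx R -> Cplx R) :
  (forall t, D t -> laurent_solution u a c t) ->
  sqrt_branch (fun l x t => l - 2 * c 0%N t) gl ->
  sqrt_branch (fun l x t => x - a t) gx ->
  let G := gauge_matrix a gl gx in
  (forall t, D t ->
     regular_along a (c 0%N) (gauge_l G (connA u)) t /\
     regular_along a (c 0%N) (gauge_x G (connB u)) t) /\
  (open D ->
   smooth_on D a -> smooth_on D (c 0%N) ->
   smooth_on D (c 3%N) -> smooth_on D (c 6%N) ->
   (forall t, D t ->
      c 0%N t = a^`()%classic t /\ c 3%N t = 2 * a^`(2)%classic t) ->
   forall t, D t -> regular_along a (c 0%N) (gauge_t G (connC u)) t).
Proof.
move=> Hu Hgl Hgx G.
have GE l x t : x - a t != 0 -> l - 2 * c 0%N t != 0 ->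
    G l x t = gauge_rat (x - a t) (l - 2 * c 0%N t).
  by move=> z0 m0; apply: gauge_matrix_rat; rewrite // -subr_eq0.
have D1 (b x : Cplx R) : is_derive x (1 : Cplx R) (fun y => y - b) 1.
  by apply: is_derive_eq; rewrite subr0.
have D0 (b x : Cplx R) : is_derive x (1 : Cplx R) (fun=> b) 0 by exact: is_derive_cst.
have sol t : D t -> exists r, [/\ 0 < r,
    forall x, 0 < `|x - a t| < r -> exists2 s : (Cplx R)^o,
      power_series_sum (fun k => c k t : (Cplx R)^o) (x - a t) s &
      u x t = - (x - a t) ^- 2 + s &
    forall x, 0 < `|x - a t| < r -> solves_PI2_at u x t].
  by move=> /Hu[r r0 H]; exists r; split => // x /H[].
have punct (b x r : Cplx R) : 0 < `|x - b| < r -> x - b != 0.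
  by move=> /andP[x0 _]; rewrite -normr_gt0.
split=> [t Dt|oD sa sc0 _ _ ac t Dt]; have [r [r0 ut odet]] := sol t Dt.
  (* The punctured disc of the Laurent series serves for every [l] at once. *)
  split; exists r => // l; rewrite -subr_eq0 => m0.
  - have [d dP] := connA_regular _ _ _ _ _ r0 ut odet _ m0.
    exists d => x xr; have z0 := punct _ _ _ xr; have := dP x xr.
    have dG : (fun l' => G l' x t)^`()%classic l =
        gauge_rat_derive (x - a t) (l - 2 * c 0%N t) 0 1.
      apply: (derive1_gauge_rat _ _ _ _ _ _ (D0 (x - a t) l) (D1 (2 * c 0%N t) l) z0 m0).
      by move=> l' z0' m0'; exact: GE.
    by rewrite /gauge_l (GE _ _ _ z0 m0) dG subrK.
  - have [d dP] := connB_regular _ _ _ _ _ r0 ut odet _ m0.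
    exists d => x xr; have z0 := punct _ _ _ xr; have := dP x xr.
    have dG : (fun x' => G l x' t)^`()%classic x =
        gauge_rat_derive (x - a t) (l - 2 * c 0%N t) 1 0.
      apply: (derive1_gauge_rat _ _ _ _ _ _ (D1 (a t) x) (D0 (l - 2 * c 0%N t) x) z0 m0).
      by move=> x' z0' m0'; exact: GE.
    by rewrite /gauge_x (GE _ _ _ z0 m0) dG subrK.
exists r => // l; rewrite -subr_eq0 => m0.
have [d dP] := connC_regular _ _ _ _ _ r0 ut odet _ m0.
have [c0t c3t] := ac t Dt.
have da : is_derive t (1 : Cplx R) a (c 0%N t).
  rewrite c0t derive1E; apply/derivableP; have := sa 0%N t Dt.
  by rewrite derive1n0.
(* The derivative of [c 0] needs [c 0 = a'] on a neighbourhood of [t], which the openness of [D]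
   provides; then [c0' = a'' = c3 / 2]. *)
have dc0 : is_derive t (1 : Cplx R) (c 0%N) (c 3%N t / 2).
  apply: DeriveDef; first by have := sc0 0%N t Dt; rewrite derive1n0.
  have -> : c 3%N t / 2 = 'D_1 (a^`()%classic) t.
    rewrite c3t derive1nS derive1n1 derive1E; move: ('D_1 _ t) => w.
    by rewrite mulrC mulKf.
  apply: near_eq_derive; have := open_nbhs_nbhs (conj oD Dt).
  by apply: filterS => s Ds; have [] := ac s Ds.
exists d => x xr; have z0 := punct _ _ _ xr; have := dP x xr.
have Dz : is_derive t (1 : Cplx R) (fun t' => x - a t') (- c 0%N t).
  by apply: is_derive_eq (is_deriveB (D0 x t) da) _; rewrite sub0r.
have Dm : is_derive t (1 : Cplx R) (fun t' => l - 2 * c 0%N t') (- c 3%N t).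
  apply: is_derive_eq (is_deriveB (D0 l t) (is_deriveZ 2 dc0)) _.
  by rewrite scale_regularE sub0r mulrC divfK.
have dG : (fun t' => G l x t')^`()%classic t =
    gauge_rat_derive (x - a t) (l - 2 * c 0%N t) (- c 0%N t) (- c 3%N t).
  apply: (derive1_gauge_rat _ _ _ _ _ _ Dz Dm z0 m0).
  by move=> t' z0' m0'; exact: GE.
by rewrite /gauge_t (GE _ _ _ z0 m0) dG subrK.
Qed.
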